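(* Let $b_1,b_2:\mathbb{R}\to\mathbb{H}^3_1$ be two regular curves with $b_1(0)=b_2(0)=1$, such that $-\langle b_1',b_1'\rangle=\langle b_2',b_2'\rangle=1$ and $\langle b_1',b_1j\rangle=\langle b_2',b_2j\rangle=0$. Consider the timelike flat surface $$f(s,t)=b_1(s)\,\overline{b_2(t)}:\mathbb{R}^2\to\mathbb{H}^3_1,$$ which has no singular points (i.e. $f$ is an immersion on all of $\mathbb{R}^2$). Then: 1. The asymptotic parameters $(u,v)$ of $f$ are globally defined on $\mathbb{R}^2$ (i.e. $(s,t)\mapsto(u(s),v(t))$ is a diffeomorphism of $\mathbb{R}^2$ onto $\mathbb{R}^2$). 2. The surface $f$ is geodesically complete if the angle function $\omega(u,v)=\omega_1(u)+\omega_2(v)$ associated to the asymptotic parameters $(u,v)$ verifies $0<c\le\sin\omega(u,v)$ for all $(u,v)$, for some constant $c>0$. 3. There exist regular curves $b_1,b_2:\mathbb{R}\to\mathbb{H}^3_1$ with $b_1(0)=b_2(0)=1$, $-\langle b_1',b_1'\rangle=\langle b_2',b_2'\rangle=1$ and $\langle b_1',b_1j\rangle=\langle b_2',b_2j\rangle=0$ for which the resulting timelike flat surface $f(s,t)=b_1(s)\,\overline{b_2(t)}$ is not geodesically complete.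
   Context: $\mathbb{R}^4_2$ is $\mathbb{R}^4$ with the metric $\langle\ ,\ \rangle=-dx_0^2-dx_1^2+dx_2^2+dx_3^2$, identified with the associative algebra $\{x_0+x_1i+x_2j+x_3k\}$ with unit $1$ and products $i^2=-1$, $j^2=k^2=1$, $ij=k$, $ji=-k$, $ik=-j$, $ki=j$, $jk=-i$, $kj=i$. Conjugation is $\overline{x_0+x_1i+x_2j+x_3k}=x_0-x_1i-x_2j-x_3k$. The anti-de Sitter space is $\mathbb{H}^3_1=\{z\in\mathbb{R}^4_2:\langle z,z\rangle=-1\}=\{z: z\bar z=1\}$, a Lie group. A surface is timelike flat if the induced metric is Lorentzian and flat. For a regular curve $a$ in $\mathbb{H}^3_1$ with $\langle a',aj\rangle=0$ one has $\bar a a'=\lambda i+\mu k$; the parameter of $a$ is the asymptotic parameter if $\lambda^2+\mu^2=1$, and then $\bar a a'=\cos(\omega^a)\,i+\sin(\omega^a)\,k$ for a smooth function $\omega^a$, unique up to adding a constant in $2\pi\mathbb{Z}$. The asymptotic parameters $(u,v)$ of $f$ are obtained by reparametrizing $b_1(s)$ and $b_2(t)$ as $a_1(u)=b_1(s(u))$, $a_2(v)=b_2(t(v))$ by their asymptotic parameters, with $u=0$ at $s=0$ and $v=0$ at $t=0$. The associated angle functions are $\omega_1=\omega^{a_1}$ and $\omega_2=\pi-\omega^{a_2}$, where, reversing the orientation of $v$ if necessary (which changes $\omega_2$ by $\pi$ and $v$ into $-v$) and using the $2\pi\mathbb{Z}$-ambiguity, one normalizes so that $\omega=\omega_1+\omega_2$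 takes values in $(0,\pi)$. *)

(* Defs.v *)
(* Stdlib reals with Coquelicot.  All curves and surfaces are C^infinity. *)
From Stdlib Require Import Reals Lra.
From Coquelicot Require Import Coquelicot.
Open Scope R_scope.

(** ** The algebra R^4_2 *)

Record R42 : Type := mkR42 { x0 : R; x1 : R; x2 : R; x3 : R }.

Definition q0 : R42 := mkR42 0 0 0 0.
Definition q1 : R42 := mkR42 1 0 0 0.
Definition qi : R42 := mkR42 0 1 0 0.
Definition qj : R42 := mkR42 0 0 1 0.
Definition qk : R42 := mkR42 0 0 0 1.

Definition qadd (z w : R42) : R42 :=
  mkR42 (x0 z + x0 w) (x1 z + x1 w) (x2 z + x2 w) (x3 z + x3 w).

Definition qscal (c : R) (z : R42) : R42 :=
  mkR42 (c * x0 z) (c * x1 z) (c * x2 z) (c * x3 z).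

Definition qopp (z : R42) : R42 := qscal (-1) z.

(* The bilinear product determined by the table [qmul_table] below. *)
Definition qmul (z w : R42) : R42 :=
  mkR42 (x0 z * x0 w - x1 z * x1 w + x2 z * x2 w + x3 z * x3 w)
        (x0 z * x1 w + x1 z * x0 w - x2 z * x3 w + x3 z * x2 w)
        (x0 z * x2 w + x2 z * x0 w - x1 z * x3 w + x3 z * x1 w)
        (x0 z * x3 w + x3 z * x0 w + x1 z * x2 w - x2 z * x1 w).

Definition qconj (z : R42) : R42 := mkR42 (x0 z) (- x1 z) (- x2 z) (- x3 z).

Definition qdot (z w : R42) : R :=
  - (x0 z * x0 w) - x1 z * x1 w + x2 z * x2 w + x3 z * x3 w.

Definition in_H31 (z : R42) : Prop := qdot z z = -1.

Lemma qmul_table :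
  qmul qi qi = qopp q1 /\ qmul qj qj = q1 /\ qmul qk qk = q1 /\
  qmul qi qj = qk /\ qmul qj qi = qopp qk /\
  qmul qi qk = qopp qj /\ qmul qk qi = qj /\
  qmul qj qk = qopp qi /\ qmul qk qj = qi.
Proof.
  repeat split; unfold qmul, qopp, qscal, q1, qi, qj, qk; simpl; f_equal; ring.
Qed.

Lemma qmul_conj (z : R42) : qmul z (qconj z) = qscal (- qdot z z) q1.
Proof. unfold qmul, qconj, qscal, qdot, q1; simpl; f_equal; ring. Qed.

(** ** Smoothness *)

Definition smooth_at (h : R -> R) (x : R) : Prop :=
  forall n : nat, ex_derive_n h n x.

Definition smooth (h : R -> R) : Prop := forall x : R, smooth_at h x.

Definition smooth2 (h : R -> R -> R) : Prop :=
  forall (n : nat) (x y : R), ex_diff_n h n x y.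

Definition curve_smooth_at (b : R -> R42) (s : R) : Prop :=
  smooth_at (fun r => x0 (b r)) s /\ smooth_at (fun r => x1 (b r)) s /\
  smooth_at (fun r => x2 (b r)) s /\ smooth_at (fun r => x3 (b r)) s.

Definition dcurve (b : R -> R42) (s : R) : R42 :=
  mkR42 (Derive (fun r => x0 (b r)) s) (Derive (fun r => x1 (b r)) s)
        (Derive (fun r => x2 (b r)) s) (Derive (fun r => x3 (b r)) s).

Definition smooth_map (F : R * R -> R * R) : Prop :=
  smooth2 (fun x y => fst (F (x, y))) /\ smooth2 (fun x y => snd (F (x, y))).

Definition diffeomorphism (F : R * R -> R * R) : Prop :=
  smooth_map F /\
  exists G : R * R -> R * R,
    smooth_map G /\ (forall p, G (F p) = p) /\ (forall p, F (G p) = p).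

(** ** Metrics on the (s,t)-plane *)

Inductive axis : Type := axS | axT.

Definition axis_eqb (i j : axis) : bool :=
  match i, j with axS, axS => true | axT, axT => true | _, _ => false end.

Definition other (i : axis) : axis := match i with axS => axT | axT => axS end.

Definition sum_axis (F : axis -> R) : R := F axS + F axT.

Definition partial (i : axis) (h : R -> R -> R) (s t : R) : R :=
  match i with
  | axS => Derive (fun r => h r t) s
  | axT => Derive (fun r => h s r) t
  end.

Definition metric : Type := axis -> axis -> R -> R -> R.

Definition metric_eval (g : metric) (s t : R) (X Y : axis -> R) : R :=
  sum_axis (fun i => sum_axis (fun j => g i j s t * X i * Y j)).

(* Signature (-,+), witnessed by an orthonormal basis of the tangent plane. *)
Definition lorentzian (g : metric) : Prop :=
  forall s t : R, exists X Y : axis -> R,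
    metric_eval g s t X X = -1 /\ metric_eval g s t Y Y = 1 /\
    metric_eval g s t X Y = 0.

Definition gdet (g : metric) (s t : R) : R :=
  g axS axS s t * g axT axT s t - g axS axT s t * g axT axS s t.

Definition ginv (g : metric) (i j : axis) (s t : R) : R :=
  (if axis_eqb i j then g (other i) (other i) s t else - g i j s t)
  / gdet g s t.

(* [christoffel g k i j] has upper index k. *)
Definition christoffel (g : metric) (k i j : axis) (s t : R) : R :=
  / 2 * sum_axis (fun l => ginv g k l s t *
    (partial i (g j l) s t + partial j (g i l) s t - partial l (g i j) s t)).

(* d_l-component of R(d_i, d_j) d_k for the Levi-Civita connection. *)
Definition riemann (g : metric) (l k i j : axis) (s t : R) : R :=
  partial i (christoffel g l j k) s t - partial j (christoffel g l i k) s t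
  + sum_axis (fun m => christoffel g l i m s t * christoffel g m j k s t
                       - christoffel g l j m s t * christoffel g m i k s t).

Definition flat (g : metric) : Prop :=
  forall (l k i j : axis) (s t : R), riemann g l k i j s t = 0.

Definition geodesic_on (g : metric) (a b : Rbar) (gam : axis -> R -> R) : Prop :=
  forall r : R, Rbar_lt a r -> Rbar_lt r b ->
    (forall k, smooth_at (gam k) r) /\
    (forall k, Derive_n (gam k) 2 r +
       sum_axis (fun i => sum_axis (fun j =>
         christoffel g k i j (gam axS r) (gam axT r)
         * Derive (gam i) r * Derive (gam j) r)) = 0).

(* Every geodesic on an open interval is the restriction of a geodesic defined
   on the whole real line. *)
Definition geodesically_complete (g : metric) : Prop :=
  forall (a b : Rbar) (gam : axis -> R -> R),
    Rbar_lt a b -> geodesic_on g a b gam ->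
    exists Gam : axis -> R -> R,
      geodesic_on g m_infty p_infty Gam /\
      (forall (k : axis) (r : R),
         Rbar_lt a r -> Rbar_lt r b -> Gam k r = gam k r).

(** ** Surfaces in H^3_1 parametrized by the plane *)

Definition surface : Type := R -> R -> R42.

Definition dsurface (f : surface) (i : axis) (s t : R) : R42 :=
  match i with
  | axS => dcurve (fun r => f r t) s
  | axT => dcurve (fun r => f s r) t
  end.

Definition surface_smooth (f : surface) : Prop :=
  smooth2 (fun s t => x0 (f s t)) /\ smooth2 (fun s t => x1 (f s t)) /\
  smooth2 (fun s t => x2 (f s t)) /\ smooth2 (fun s t => x3 (f s t)).

Definition immersion (f : surface) : Prop :=
  surface_smooth f /\
  forall (s t : R) (X : axis -> R),
    qadd (qscal (X axS) (dsurface f axS s t))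
         (qscal (X axT) (dsurface f axT s t)) = q0 ->
    forall i, X i = 0.

Definition induced_metric (f : surface) : metric :=
  fun i j s t => qdot (dsurface f i s t) (dsurface f j s t).

Definition timelike_flat_surface (f : surface) : Prop :=
  (forall s t, in_H31 (f s t)) /\ immersion f /\
  lorentzian (induced_metric f) /\ flat (induced_metric f).

Definition surface_of (b1 b2 : R -> R42) : surface :=
  fun s t => qmul (b1 s) (qconj (b2 t)).

(** ** The curves and their asymptotic parameters *)

Definition regular_curve_H31 (b : R -> R42) : Prop :=
  forall s, curve_smooth_at b s /\ in_H31 (b s) /\ dcurve b s <> q0.

Definition admissible_pair (b1 b2 : R -> R42) : Prop :=
  regular_curve_H31 b1 /\ regular_curve_H31 b2 /\ b1 0 = q1 /\ b2 0 = q1 /\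
  (forall s, - qdot (dcurve b1 s) (dcurve b1 s) = 1) /\
  (forall t, qdot (dcurve b2 t) (dcurve b2 t) = 1) /\
  (forall s, qdot (dcurve b1 s) (qmul (b1 s) qj) = 0) /\
  (forall t, qdot (dcurve b2 t) (qmul (b2 t) qj) = 0).

Definition log_derivative (a : R -> R42) (x : R) : R42 :=
  qmul (qconj (a x)) (dcurve a x).

Definition asymptotic_at (a : R -> R42) (x : R) : Prop :=
  exists lam mu : R,
    log_derivative a x = qadd (qscal lam qi) (qscal mu qk) /\
    lam ^ 2 + mu ^ 2 = 1.

(* [u] is a regular change of parameter, of either orientation, defined on all
   of R but not assumed onto; [a] is [b] reparametrized by it, and only its
   values on the (open) image of [u] matter. *)
Definition asymptotic_parameter (b : R -> R42) (u : R -> R) (a : R -> R42)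
  : Prop :=
  smooth u /\ u 0 = 0 /\ (forall s, Derive u s <> 0) /\
  (forall s, a (u s) = b s) /\
  (forall s, curve_smooth_at a (u s) /\ asymptotic_at a (u s)).

(* The orientation of [v] is left free: it may have to be reversed in
   [normalized_angles]. *)
Definition asymptotic_parameters
  (b1 b2 : R -> R42) (u v : R -> R) (a1 a2 : R -> R42) : Prop :=
  asymptotic_parameter b1 u a1 /\ (forall s, 0 < Derive u s) /\
  asymptotic_parameter b2 v a2.

Definition angle_function (a : R -> R42) (w : R -> R) : Prop :=
  smooth w /\
  forall x, log_derivative a x = qadd (qscal (cos (w x)) qi) (qscal (sin (w x)) qk).

Definition normalized_angles (a1 a2 : R -> R42) (w1 w2 : R -> R) : Prop :=
  angle_function a1 w1 /\
  (exists w, angle_function a2 w /\ forall y, w2 y = PI - w y) /\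
  (forall x y, 0 < w1 x + w2 y < PI).

(* Main.v *)
Require Import Defs.
From Stdlib Require Import Reals Lra Lia Nsatz FunctionalExtensionality IndefiniteDescription Classical.
From Coquelicot Require Import Coquelicot.
Open Scope R_scope.

(** Write [lam i + mu k] for the logarithmic derivative of an admissible curve.
    For [b1] one has [lam1^2 - mu1^2 = 1] and for [b2] one has
    [mu2^2 - lam2^2 = 1], so [P = lam1 + mu1] and [Q = lam2 + mu2] never vanish,
    with [1/P = lam1 - mu1] and [1/Q = mu2 - lam2].  The induced metric is
    [-ds^2 + (Q/P - P/Q) ds dt + dt^2], which factors as
    [(- P ds + Q dt) (ds/P + dt/Q)] (lemma [induced_metric_null]).  Both factors
    are closed forms in separated variables, so the metric is flat, with null
    coordinates [X = int ds/P + int dt/Q] and [Y = - int P ds + int Q dt].  The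
    map [(X, Y)] is always injective, being monotone in a suitable sense
    ([null_separates]), and the geodesics are the curves along which [X] and [Y]
    are affine ([geodesic_iff_affine]).  If [(X, Y)] is onto the plane, the
    preimages of straight lines are smooth, by Caratheodory's form of
    differentiability and bootstrapping, and the metric is complete
    ([null_metric_complete]).

    An asymptotic parameter [u] of [b] satisfies [u'^2 = lam^2 + mu^2 >= 1], so
    it is a diffeomorphism of the line.  Existence is by integration, and the
    angles are arctangents of [mu1/lam1] and [lam2/mu2], which have absolute
    value less than [PI/4]; this leaves room for the normalization.

    In terms of [x = P^2] and [y = Q^2] the bound [c <= sin omega] becomes
    [c^2 (x^2 + 1) (y^2 + 1) <= (x + y)^2].  A large value of [x] then forces
    [y] to be bounded, and a small one forces [y] to be bounded below.  Hence
    one of four cases holds: [P] is bounded above and below, [Q] is bounded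
    above and below, [P] is bounded below and [Q] above, or [P] is bounded above
    and [Q] below (in absolute value).  Up to exchanging [s] with [t], or [X]
    with [Y], the level sets of [X] are graphs over the [t]-axis along which the
    derivative of [Y] is bounded away from zero, whence surjectivity
    ([null_onto_of_angle_bound]).

    For the incomplete surface, products of two one-parameter subgroups give
    explicit curves with [P = exp (2 s)] and [Q = exp (2 t)]; then [X] is
    bounded above, and the geodesic [Y = 0] leaves every compact set in finite
    time. *)

(** * Differentiability of finite order on a set *)

(** [Ck n D f]: on [D], the function [f] has [n] successive derivatives.  The
    derivatives are quantified existentially, so that closure properties never
    require rewriting with [Derive]; [D] is meant to be open. *)
Fixpoint Ck (n : nat) (D : R -> Prop) (f : R -> R) : Prop :=
  match n with
  | O => True
  | S m => exists f', (forall x, D x -> is_derive f x (f' x)) /\ Ck m D f'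
  end.

(** The whole line, as a set. *)
Definition allR (x : R) : Prop := True.

Lemma Ck_pred n D f : Ck (S n) D f -> Ck n D f.
Proof.
revert f; induction n as [|n IH]; intros f H; [exact I|].
destruct H as [f' [H1 H2]]; exists f'; split; [exact H1|now apply IH].
Qed.

Lemma Ck_const n D c : Ck n D (fun _ => c).
Proof.
revert c; induction n as [|n IH]; intros c; [exact I|].
exists (fun _ => 0); split; [intros x _; auto_derive; auto|apply IH].
Qed.

Lemma Ck_id n D : Ck n D (fun x => x).
Proof.
destruct n as [|n]; [exact I|].
exists (fun _ => 1); split; [intros x _; auto_derive; auto|apply Ck_const].
Qed.

Lemma Ck_plus n D f g : Ck n D f -> Ck n D g -> Ck n D (fun x => f x + g x).
Proof.
revert f g; induction n as [|n IH]; intros f g Hf Hg; [exact I|].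
destruct Hf as [f' [Hf1 Hf2]], Hg as [g' [Hg1 Hg2]].
exists (fun x => f' x + g' x); split; [|now apply IH].
intros x Hx; apply (is_derive_plus f g x (f' x) (g' x)); auto.
Qed.

Lemma Ck_mult n D f g : Ck n D f -> Ck n D g -> Ck n D (fun x => f x * g x).
Proof.
revert f g; induction n as [|n IH]; intros f g Hf Hg; [exact I|].
pose proof (Ck_pred _ _ _ Hf) as Hf0; pose proof (Ck_pred _ _ _ Hg) as Hg0.
destruct Hf as [f' [Hf1 Hf2]], Hg as [g' [Hg1 Hg2]].
exists (fun x => f' x * g x + f x * g' x); split.
- intros x Hx; apply (is_derive_mult f g x (f' x) (g' x)); auto.
  intros; apply Rmult_comm.
- apply Ck_plus; apply IH; auto.
Qed.

Lemma Ck_comp n D E f g :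
  (forall x, D x -> E (g x)) -> Ck n E f -> Ck n D g ->
  Ck n D (fun x => f (g x)).
Proof.
intros HDE; revert f; induction n as [|n IH]; intros f Hf Hg; [exact I|].
pose proof (Ck_pred _ _ _ Hg) as Hg0.
destruct Hf as [f' [Hf1 Hf2]], Hg as [g' [Hg1 Hg2]].
exists (fun x => g' x * f' (g x)); split.
- intros x Hx; apply (is_derive_comp f g x (f' (g x)) (g' x)); auto.
- apply Ck_mult; auto.
Qed.

Lemma Ck_opp n D f : Ck n D f -> Ck n D (fun x => - f x).
Proof.
intros H; apply (Ck_comp n D allR (fun y => - y) f); unfold allR; auto.
destruct n as [|n]; [exact I|].
exists (fun _ => -1); split; [intros x _; auto_derive; auto; ring|apply Ck_const].
Qed.

Lemma Ck_minus n D f g : Ck n D f -> Ck n D g -> Ck n D (fun x => f x - g x).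
Proof. intros Hf Hg; apply Ck_plus; [|apply Ck_opp]; assumption. Qed.

Lemma Ck_Rinv n : Ck n (fun x => x <> 0) Rinv.
Proof.
induction n as [|n IH]; [exact I|].
exists (fun x => - (/ x * / x)); split.
- intros x Hx; auto_derive; auto; field; auto.
- apply Ck_opp, Ck_mult; exact IH.
Qed.

Lemma Ck_inv n D f :
  (forall x, D x -> f x <> 0) -> Ck n D f -> Ck n D (fun x => / f x).
Proof. intros H0 Hf; exact (Ck_comp n D _ Rinv f H0 (Ck_Rinv n) Hf). Qed.

Lemma Ck_div n D f g :
  (forall x, D x -> g x <> 0) -> Ck n D f -> Ck n D g ->
  Ck n D (fun x => f x / g x).
Proof. intros; apply Ck_mult; [|apply Ck_inv]; assumption. Qed.

Lemma Ck_sqrt n : Ck n (fun x => 0 < x) sqrt.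
Proof.
induction n as [|n IH]; [exact I|].
exists (fun x => / (2 * sqrt x)); split.
- intros x Hx; auto_derive; auto; field.
  apply Rgt_not_eq, sqrt_lt_R0, Hx.
- apply Ck_inv; [|apply Ck_mult; [apply Ck_const|exact IH]].
  intros x Hx; pose proof (sqrt_lt_R0 x Hx); lra.
Qed.

Lemma Ck_exp n D : Ck n D exp.
Proof.
induction n as [|n IH]; [exact I|].
exists exp; split; [intros x _; auto_derive; auto; ring|exact IH].
Qed.

Lemma Ck_ln n : Ck n (fun x => 0 < x) ln.
Proof.
destruct n as [|n]; [exact I|].
exists (fun x => / x); split; [intros x Hx; auto_derive; auto; field; lra|].
apply Ck_inv; [intros x Hx; lra|apply Ck_id].
Qed.

Lemma Ck_atan n D : Ck n D atan.
Proof.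
destruct n as [|n]; [exact I|].
exists (fun x => / (1 + x * x)); split.
- intros x _; replace (/ (1 + x * x)) with (/ (1 + x ^ 2)) by (f_equal; ring).
  apply is_derive_Reals, derivable_pt_lim_atan.
- apply Ck_inv; [intros x _; nra|].
  apply Ck_plus; [apply Ck_const|apply Ck_mult; apply Ck_id].
Qed.

Lemma ex_derive_n_Ck (D : R -> Prop) f :
  (forall x, D x -> smooth_at f x) -> forall n, Ck n D f.
Proof.
intros H n.
enough (G : forall k, Ck n D (Derive_n f k)) by exact (G O).
induction n as [|n IH]; intros k; [exact I|].
exists (Derive_n f (S k)); split; [|apply IH].
intros x Hx; apply Derive_correct; exact (H x Hx (S k)).
Qed.

Lemma Ck_ex_derive_n n D f x :
  open D -> Ck n D f -> D x -> ex_derive_n f n x.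
Proof.
intros HD; revert f x; induction n as [|n IH]; intros f x Hf Hx; [exact I|].
destruct Hf as [f' [Hf1 Hf2]]; destruct n as [|n].
- exists (f' x); now apply Hf1.
- apply (ex_derive_ext_loc (Derive_n f' n)); [|exact (IH f' x Hf2 Hx)].
  apply filter_imp with (2 := HD x Hx); intros y Hy.
  transitivity (Derive_n (Derive_n f 1) n y);
    [|now rewrite Derive_n_comp; f_equal; lia].
  apply Derive_n_ext_loc; apply filter_imp with (2 := HD y Hy).
  intros z Hz; symmetry; apply is_derive_unique; now apply Hf1.
Qed.

Lemma open_allR : open allR.
Proof. apply open_true. Qed.

Lemma Ck_smooth_at D f x :
  open D -> (forall n, Ck n D f) -> D x -> smooth_at f x.
Proof. intros HD Hf Hx n; exact (Ck_ex_derive_n n D f x HD (Hf n) Hx). Qed.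

Lemma smooth_Ck f : smooth f <-> forall n, Ck n allR f.
Proof.
split.
- intros H; apply ex_derive_n_Ck; intros x _; apply H.
- intros H x; exact (Ck_smooth_at allR f x open_allR H I).
Qed.

Lemma smooth_ex_derive f x : smooth f -> ex_derive f x.
Proof. intros H; exact (H x 1%nat). Qed.

Lemma smooth_Derive f : smooth f -> smooth (Derive f).
Proof.
intros H; apply smooth_Ck; intros n.
apply (ex_derive_n_Ck allR); intros x _ m.
apply (ex_derive_n_ext (Derive_n f 1)); [reflexivity|].
destruct m as [|m]; [exact I|].
apply (ex_derive_ext (Derive_n f (S m))); [|exact (H x (S (S m)))].
intros y; rewrite Derive_n_comp; f_equal; lia.
Qed.

Lemma smooth_continuous f x : smooth f -> continuous f x.
Proof. intros H; apply (ex_derive_continuous (V := R_NormedModule)), smooth_ex_derive, H. Qed.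

(** ** Smooth functions of two variables in separated form *)

Lemma ex_diff_n_plus n x y : forall f g,
  (forall x y, ex_diff_n f n x y) -> (forall x y, ex_diff_n g n x y) ->
  ex_diff_n (fun a b => f a b + g a b) n x y.
Proof.
revert x y; induction n as [|n IH]; intros x y f g Hf Hg.
- split; [|exact I].
  apply continuity_2d_pt_plus; [apply (Hf x y)|apply (Hg x y)].
- assert (Hfx : forall x y, ex_derive (fun z => f z y) x)
    by (intros x' y'; apply (Hf x' y')).
  assert (Hfy : forall x y, ex_derive (fun z => f x z) y)
    by (intros x' y'; apply (Hf x' y')).
  assert (Hgx : forall x y, ex_derive (fun z => g z y) x)
    by (intros x' y'; apply (Hg x' y')).
  assert (Hgy : forall x y, ex_derive (fun z => g x z) y)
    by (intros x' y'; apply (Hg x' y')).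
  split; [apply continuity_2d_pt_plus; [apply (Hf x y)|apply (Hg x y)]|].
  split; [now apply (ex_derive_plus (fun z => f z y) (fun z => g z y))|].
  split; [now apply (ex_derive_plus (fun z => f x z) (fun z => g x z))|].
  split.
  + replace (fun u v : R => Derive (fun z : R => f z v + g z v) u)
      with (fun u v => Derive (fun z => f z v) u + Derive (fun z => g z v) u).
    * apply IH; intros x' y'; [apply (Hf x' y')|apply (Hg x' y')].
    * apply functional_extensionality; intros u.
      apply functional_extensionality; intros v.
      symmetry; now apply Derive_plus.
  + replace (fun u v : R => Derive (fun z : R => f u z + g u z) v)
      with (fun u v => Derive (fun z => f u z) v + Derive (fun z => g u z) v).
    * apply IH; intros x' y'; [apply (Hf x' y')|apply (Hg x' y')].
    * apply functional_extensionality; intros u.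
      apply functional_extensionality; intros v.
      symmetry; now apply Derive_plus.
Qed.

Lemma smooth2_plus f g :
  smooth2 f -> smooth2 g -> smooth2 (fun x y => f x y + g x y).
Proof.
intros Hf Hg n x y; apply ex_diff_n_plus; intros; [apply Hf|apply Hg].
Qed.

Lemma smooth2_tensor h k :
  smooth h -> smooth k -> smooth2 (fun x y => h x * k y).
Proof.
intros Hh Hk n; revert h k Hh Hk.
induction n as [|n IH]; intros h k Hh Hk x y.
- split; [|exact I].
  apply continuity_2d_pt_mult.
  + apply (continuity_1d_2d_pt_comp h (fun a b => a)); [|apply continuity_2d_pt_id1].
    apply continuity_pt_filterlim, smooth_continuous, Hh.
  + apply (continuity_1d_2d_pt_comp k (fun a b => b)); [|apply continuity_2d_pt_id2].
    apply continuity_pt_filterlim, smooth_continuous, Hk.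
- assert (C : continuity_2d_pt (fun x y => h x * k y) x y) by (generalize (IH h k Hh Hk x y); destruct n; intros E; apply E).
  split; [exact C|].
  split; [apply ex_derive_mult; [apply smooth_ex_derive, Hh|apply ex_derive_const]|].
  split; [apply ex_derive_mult; [apply ex_derive_const|apply smooth_ex_derive, Hk]|].
  split.
  + replace (fun u v => Derive (fun z => h z * k v) u)
      with (fun u v => Derive h u * k v).
    * apply IH; [apply smooth_Derive, Hh|exact Hk].
    * apply functional_extensionality; intros u.
      apply functional_extensionality; intros v.
      symmetry; apply Derive_scal_l.
  + replace (fun u v => Derive (fun z => h u * k z) v)
      with (fun u v => h u * Derive k v).
    * apply IH; [exact Hh|apply smooth_Derive, Hk].
    * apply functional_extensionality; intros u.
      apply functional_extensionality; intros v.
      symmetry; apply Derive_scal.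
Qed.

Lemma smooth_const c : smooth (fun _ => c).
Proof. apply smooth_Ck; intros n; apply Ck_const. Qed.

Lemma smooth_opp f : smooth f -> smooth (fun x => - f x).
Proof. rewrite !smooth_Ck; intros H n; apply Ck_opp, H. Qed.

Lemma smooth2_fst h : smooth h -> smooth2 (fun x _ => h x).
Proof.
intros H; replace (fun x _ : R => h x) with (fun x y : R => h x * 1).
- exact (smooth2_tensor h (fun _ => 1) H (smooth_const 1)).
- apply functional_extensionality; intros u.
  apply functional_extensionality; intros v; ring.
Qed.

Lemma smooth2_snd h : smooth h -> smooth2 (fun _ y => h y).
Proof.
intros H; replace (fun _ y : R => h y) with (fun x y : R => 1 * h y).
- exact (smooth2_tensor (fun _ => 1) h (smooth_const 1) H).
- apply functional_extensionality; intros u.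
  apply functional_extensionality; intros v; ring.
Qed.

(** * Inverse functions of one variable *)

(** Caratheodory's form of differentiability. *)
Lemma is_derive_slope (f : R -> R) (x l : R) :
  is_derive f x l ->
  exists phi : R -> R, continuous phi x /\ phi x = l /\
    forall y : R, f y - f x = phi y * (y - x).
Proof.
intros H.
exists (fun y : R => if Req_EM_T y x then l else (f y - f x) / (y - x)).
split; [|split].
- apply is_derive_Reals in H.
  apply continuity_pt_filterlim.
  intros eps He; destruct (H eps He) as [d Hd].
  exists d; split; [apply cond_pos|]; intros y [[_ Hy] Hdy].
  simpl in *; unfold Rdist in *.
  destruct (Req_EM_T x x) as [_|N]; [|now elim N].
  destruct (Req_EM_T y x) as [E|N]; [now elim Hy|].
  specialize (Hd (y - x)); replace (x + (y - x)) with y in Hd by ring.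
  apply Hd; [intros E; apply N; lra|exact Hdy].
- destruct (Req_EM_T x x) as [_|N]; [reflexivity|now elim N].
- intros y; destruct (Req_EM_T y x) as [->|N]; [ring|field; lra].
Qed.

Lemma slope_is_derive (f : R -> R) (x : R) (phi : R -> R) :
  continuous phi x -> (forall y : R, f y - f x = phi y * (y - x)) ->
  is_derive f x (phi x).
Proof.
intros Hc H; apply is_derive_Reals; intros eps He.
apply continuity_pt_filterlim in Hc.
destruct (Hc eps He) as [d [Hd1 Hd2]].
exists (mkposreal d Hd1); intros h Hh Hhd; simpl in Hhd.
rewrite H; replace (phi (x + h) * (x + h - x) / h) with (phi (x + h))
  by (field; exact Hh).
apply Hd2; split; [split; [exact I|lra]|].
simpl; unfold Rdist; now replace (x + h - x) with h by ring.
Qed.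

Lemma is_derive_cont (f : R -> R) (x l : R) : is_derive f x l -> continuous f x.
Proof.
intros H; apply (ex_derive_continuous (V := R_NormedModule)); now exists l.
Qed.

(** The mean value theorem for a function differentiable everywhere. *)
Lemma MVT_R (f f' : R -> R) (a b : R) :
  (forall x, is_derive f x (f' x)) -> exists c, f b - f a = f' c * (b - a).
Proof.
intros H; destruct (MVT_gen f a b f') as [c [_ Hc]]; [auto| |now exists c].
intros x _; apply continuity_pt_filterlim; now apply is_derive_cont with (f' x).
Qed.

(** Slopes of a function differentiable everywhere are values of its derivative,
    so they inherit its sign. *)
Lemma global_slope (f f' : R -> R) (x : R) :
  (forall y, is_derive f y (f' y)) ->
  exists phi : R -> R, continuous phi x /\ phi x = f' x /\
    (forall y : R, f y - f x = phi y * (y - x)) /\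
    forall y, exists c, phi y = f' c.
Proof.
intros H; destruct (is_derive_slope f x (f' x) (H x)) as [phi [P1 [P2 P3]]].
exists phi; split; [exact P1|split; [exact P2|split; [exact P3|]]]; intros y.
destruct (Req_dec y x) as [->|N]; [now exists x|].
destruct (MVT_R f f' x y H) as [c Hc]; exists c; rewrite P3 in Hc.
apply Rmult_eq_reg_r with (y - x); [exact Hc|lra].
Qed.

Lemma nonvanishing_sign (f : R -> R) :
  (forall x, continuous f x) -> (forall x, f x <> 0) ->
  (forall x, 0 < f x) \/ (forall x, f x < 0).
Proof.
intros Hc H0.
assert (K : forall a b, f a < 0 -> 0 < f b -> False).
{ intros a b Ha Hb.
  destruct (IVT_gen f a b 0) as [z [_ Hz]].
  - intros x; apply continuity_pt_filterlim, Hc.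
  - rewrite Rmin_left, Rmax_right; lra.
  - exact (H0 z Hz). }
destruct (Rlt_dec 0 (f 0)) as [H|H].
- left; intros x; destruct (Rlt_dec 0 (f x)) as [Hx|Hx]; [exact Hx|].
  exfalso; apply (K x 0); [specialize (H0 x); lra|exact H].
- right; intros x; destruct (Rlt_dec (f x) 0) as [Hx|Hx]; [exact Hx|].
  exfalso; apply (K 0 x); [specialize (H0 0); lra|specialize (H0 x); lra].
Qed.

Lemma strictly_increasing_pos (f f' : R -> R) :
  (forall x, is_derive f x (f' x)) -> (forall x, 0 < f' x) ->
  forall x y, x < y -> f x < f y.
Proof.
intros H H0 x y Hxy; destruct (MVT_R f f' x y H) as [c Hc].
specialize (H0 c); assert (0 < f' c * (y - x)) by (apply Rmult_lt_0_compat; lra).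
lra.
Qed.

(** A function on the line with continuous nonvanishing derivative is injective
    with continuous inverse. *)
Lemma nonvanishing_separates (f f' : R -> R) :
  (forall x, is_derive f x (f' x)) -> (forall x, continuous f' x) ->
  (forall x, f' x <> 0) ->
  forall x0 eps, 0 < eps ->
  exists eta, 0 < eta /\ forall x, Rabs (f x - f x0) < eta -> Rabs (x - x0) < eps.
Proof.
assert (K : forall f f' : R -> R, (forall x, is_derive f x (f' x)) ->
  (forall x, 0 < f' x) -> forall x0 eps, 0 < eps ->
  exists eta, 0 < eta /\
    forall x, Rabs (f x - f x0) < eta -> Rabs (x - x0) < eps).
{ clear f f'; intros f f' H Hp x0 eps He.
  pose proof (strictly_increasing_pos f f' H Hp) as M.
  exists (Rmin (f (x0 + eps) - f x0) (f x0 - f (x0 - eps))); split.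
  - apply Rmin_glb_lt; [specialize (M x0 (x0 + eps))|specialize (M (x0 - eps) x0)];
      lra.
  - intros x Hx.
    pose proof (Rlt_le_trans _ _ _ Hx (Rmin_l _ _)) as H1.
    pose proof (Rlt_le_trans _ _ _ Hx (Rmin_r _ _)) as H2.
    apply Rabs_def2 in H1; apply Rabs_def2 in H2.
    apply Rabs_def1; apply Rnot_le_lt; intros C.
    + destruct C as [C|C]; [specialize (M (x0 + eps) x)|];
        [lra|replace x with (x0 + eps) in * by lra; lra].
    + destruct C as [C|C]; [specialize (M x (x0 - eps))|];
        [lra|replace x with (x0 - eps) in * by lra; lra]. }
intros H Hc H0 x0 eps He.
destruct (nonvanishing_sign f' Hc H0) as [P|P]; [now apply (K f f')|].
destruct (K (fun x => - f x) (fun x => - f' x)) with x0 eps as [eta [E1 E2]]; auto.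
- intros x; apply (is_derive_opp f x (f' x)), H.
- intros x; specialize (P x); lra.
- exists eta; split; [exact E1|]; intros x Hx; apply E2.
  replace (- f x - - f x0) with (- (f x - f x0)) by ring; now rewrite Rabs_Ropp.
Qed.

Lemma separates_injective (f f' : R -> R) :
  (forall x, is_derive f x (f' x)) -> (forall x, continuous f' x) ->
  (forall x, f' x <> 0) -> forall x y, f x = f y -> x = y.
Proof.
intros H Hc H0 x y E; apply Rminus_diag_uniq.
destruct (Req_dec (x - y) 0) as [Z|Z]; [exact Z|exfalso].
destruct (nonvanishing_separates f f' H Hc H0 y (Rabs (x - y)) (Rabs_pos_lt _ Z))
  as [eta [E1 E2]].
apply (Rlt_irrefl (Rabs (x - y))), E2; rewrite E, Rminus_diag, Rabs_R0; exact E1.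
Qed.

(** The bound is on the square of the derivative, to cover both signs. *)
Lemma onto_of_derive_bounded_below (f f' : R -> R) (d : R) :
  0 < d -> (forall x, is_derive f x (f' x)) -> (forall x, continuous f' x) ->
  (forall x, d <= (f' x)^2) -> forall y, exists x, f x = y.
Proof.
assert (K : forall (f f' : R -> R) (e : R), 0 < e -> (forall x, is_derive f x (f' x)) ->
  (forall x, e <= f' x) -> forall y, exists x, f x = y).
{ clear f f' d; intros f f' e He H Hb y.
  set (r := Rabs (y - f 0) / e).
  assert (R0 : 0 <= r) by (apply Rdiv_le_0_compat; [apply Rabs_pos|exact He]).
  assert (R1 : e * r = Rabs (y - f 0)) by (unfold r; field; lra).
  pose proof (Rle_abs (y - f 0)) as B1; pose proof (Rle_abs (- (y - f 0))) as B2.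
  rewrite Rabs_Ropp in B2.
  assert (U : y <= f r).
  { destruct (MVT_R f f' 0 r H) as [c Hc]; specialize (Hb c); nra. }
  assert (L : f (- r) <= y).
  { destruct (MVT_R f f' (-r) 0 H) as [c Hc]; specialize (Hb c); nra. }
  destruct (IVT_gen f (- r) r y) as [x [_ Hx]]; [| |now exists x].
  - intros x; apply continuity_pt_filterlim; now apply is_derive_cont with (f' x).
  - rewrite Rmin_left, Rmax_right; lra. }
intros Hd H Hc Hb y.
assert (S0 : 0 < sqrt d) by now apply sqrt_lt_R0.
assert (S2 : sqrt d * sqrt d = d) by (apply sqrt_sqrt; lra).
assert (N : forall x, f' x <> 0) by (intros x E; specialize (Hb x); rewrite E in Hb; nra).
destruct (nonvanishing_sign f' Hc N) as [P|P].
- apply (K f f' (sqrt d)); auto; intros x.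
  specialize (P x); specialize (Hb x); nra.
- destruct (K (fun x => - f x) (fun x => - f' x) (sqrt d)) with (- y) as [x Hx]; auto.
  + intros x; apply (is_derive_opp f x (f' x)), H.
  + intros x; specialize (P x); specialize (Hb x); nra.
  + exists x; lra.
Qed.

(** Global inverse function theorem on the line. *)
Lemma inverse_of_derive_bounded_below (f f' : R -> R) (d : R) :
  0 < d -> (forall x, is_derive f x (f' x)) -> (forall x, continuous f' x) ->
  (forall x, d <= (f' x)^2) ->
  exists g : R -> R, (forall x, g (f x) = x) /\ (forall y, f (g y) = y) /\
    forall y, is_derive g y (/ f' (g y)).
Proof.
intros Hd H Hc Hb.
assert (N : forall x, f' x <> 0) by (intros x E; specialize (Hb x); rewrite E in Hb; nra).
destruct (functional_choice (fun y x => f x = y)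
  (onto_of_derive_bounded_below f f' d Hd H Hc Hb)) as [g Hg].
exists g; split; [|split; [exact Hg|]].
- intros x; now apply (separates_injective f f' H Hc N).
- intros y.
  assert (Cg : continuous g y).
  { apply continuity_pt_filterlim; intros eps He.
    destruct (nonvanishing_separates f f' H Hc N (g y) eps He) as [eta [E1 E2]].
    exists eta; split; [exact E1|]; intros z [_ Hz].
    apply E2; rewrite !Hg; exact Hz. }
  destruct (is_derive_slope f (g y) (f' (g y)) (H (g y))) as [phi [P1 [P2 P3]]].
  assert (Z : forall z, phi (g z) <> 0).
  { intros z E; destruct (Req_dec z y) as [->|D]; [rewrite P2 in E; now apply (N (g y))|].
    specialize (P3 (g z)); rewrite !Hg, E in P3; apply D; lra. }
  rewrite <- P2; apply (slope_is_derive g y (fun z => / phi (g z))).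
  + apply continuity_pt_filterlim; apply (continuity_pt_inv (fun z => phi (g z)));
      [|apply Z].
    apply continuity_pt_filterlim; apply (continuous_comp g phi); assumption.
  + intros z; specialize (P3 (g z)); rewrite !Hg in P3; rewrite P3; field; apply Z.
Qed.

(** Bootstrapping from the equation [g' = 1 / h(g)]. *)
Lemma inverse_smooth (g h : R -> R) :
  (forall n, Ck n allR h) -> (forall x, h x <> 0) ->
  (forall y, is_derive g y (/ h (g y))) -> forall n, Ck n allR g.
Proof.
intros Hh H0 Hg n; induction n as [|n IH]; [exact I|].
exists (fun y => / h (g y)); split; [intros y _; apply Hg|].
apply Ck_inv; [intros; apply H0|].
apply (Ck_comp n allR allR h g); unfold allR; auto.
Qed.

Lemma antiderivative (f : R -> R) :
  (forall x, continuous f x) -> exists F : R -> R, F 0 = 0 /\ forall x, is_derive F x (f x).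
Proof.
intros Hc; exists (fun x => RInt f 0 x); split; [exact (RInt_point (V := R_CompleteNormedModule) 0 f)|].
intros x; apply (is_derive_RInt f (fun x => RInt f 0 x) 0); [|apply Hc].
apply filter_forall; intros y; apply (RInt_correct (V := R_CompleteNormedModule)).
apply (ex_RInt_continuous (V := R_CompleteNormedModule)); auto.
Qed.

(** * Null coordinates *)

(** The metric [(- P ds + Q dt) (ds / P + dt / Q)] has null coordinates
    [X = A1 s + B1 t] and [Y = - A2 s + B2 t], with [A1], [A2], [B1], [B2]
    antiderivatives of [1/P], [P], [1/Q], [Q]. *)
Definition null_data (P Q A1 A2 B1 B2 : R -> R) : Prop :=
  (forall s : R, continuous P s) /\ (forall t : R, continuous Q t) /\
  (forall s, P s <> 0) /\ (forall t, Q t <> 0) /\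
  (forall s : R, is_derive A1 s (/ P s)) /\ (forall s : R, is_derive A2 s (P s)) /\
  (forall t : R, is_derive B1 t (/ Q t)) /\ (forall t : R, is_derive B2 t (Q t)).

(** The null coordinates map onto the plane. *)
Definition null_onto (A1 A2 B1 B2 : R -> R) : Prop :=
  forall X Y, exists s t, A1 s + B1 t = X /\ - A2 s + B2 t = Y.

Lemma continuous_Rinv (f : R -> R) x :
  continuous f x -> f x <> 0 -> continuous (fun y => / f y) x.
Proof.
intros H H0; apply continuity_pt_filterlim, (continuity_pt_inv f);
  [now apply continuity_pt_filterlim|exact H0].
Qed.

Lemma null_data_exists P Q :
  (forall s : R, continuous P s) -> (forall t : R, continuous Q t) ->
  (forall s, P s <> 0) -> (forall t, Q t <> 0) ->
  exists A1 A2 B1 B2, null_data P Q A1 A2 B1 B2.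
Proof.
intros HP HQ P0 Q0.
destruct (antiderivative (fun s => / P s)) as [A1 [_ HA1]];
  [intros; now apply continuous_Rinv|].
destruct (antiderivative P HP) as [A2 [_ HA2]].
destruct (antiderivative (fun s => / Q s)) as [B1 [_ HB1]];
  [intros; now apply continuous_Rinv|].
destruct (antiderivative Q HQ) as [B2 [_ HB2]].
exists A1, A2, B1, B2; unfold null_data; tauto.
Qed.

(** If [1/P] is bounded away from [0], the level sets of [X] are graphs
    [s = sigma t], along which [Y] has derivative [(P^2 + Q^2) / Q]; the last hypothesis bounds
    it away from [0]. *)
Lemma null_onto_of_bounded P Q A1 A2 B1 B2 M :
  null_data P Q A1 A2 B1 B2 -> 0 < M ->
  (forall s, P s ^ 2 <= M) ->
  (forall s t, Q t ^ 2 <= M * (P s ^ 2 + Q t ^ 2) ^ 2) ->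
  null_onto A1 A2 B1 B2.
Proof.
intros [cP [cQ [P0 [Q0 [HA1 [HA2 [HB1 HB2]]]]]]] HM BP BPQ X Y.
destruct (inverse_of_derive_bounded_below A1 (fun s => / P s) (/ M)) as [g [_ [G2 G3]]].
- now apply Rinv_0_lt_compat.
- exact HA1.
- intros; now apply continuous_Rinv.
- intros s; specialize (BP s); specialize (P0 s).
  rewrite pow_inv; apply Rinv_le_contravar; [|exact BP].
  assert (0 < P s * P s) by (apply Rsqr_pos_lt; exact P0); simpl; lra.
- set (h := fun t => - A2 (g (X - B1 t)) + B2 t).
  set (h' := fun t => P (g (X - B1 t)) * P (g (X - B1 t)) * / Q t + Q t).
  assert (Hg : forall t, is_derive (fun t => g (X - B1 t)) t (- / Q t * P (g (X - B1 t)))).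
  { intros t.
    replace (- / Q t * P (g (X - B1 t))) with (- / Q t * (/ / P (g (X - B1 t))))
      by (field; split; auto).
    apply (is_derive_comp g (fun t => X - B1 t)); [apply G3|].
    auto_derive; [now exists (/ Q t)|].
    replace (Derive (fun x => B1 x) t) with (/ Q t); [ring|].
    symmetry; apply is_derive_unique, HB1. }
  assert (Hh : forall t, is_derive h t (h' t)).
  { intros t; unfold h, h'; apply (is_derive_plus (V := R_NormedModule)); [|apply HB2].
    replace (P (g (X - B1 t)) * P (g (X - B1 t)) * / Q t)
      with (- ((- / Q t * P (g (X - B1 t))) * P (g (X - B1 t)))) by ring.
    apply (is_derive_opp (V := R_NormedModule)).
    apply (is_derive_comp A2 (fun t => g (X - B1 t))); [apply HA2|apply Hg]. }
  destruct (onto_of_derive_bounded_below h h' (/ M)) with Y as [t Ht]; auto.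
  + now apply Rinv_0_lt_compat.
  + intros t.
    assert (C1 : continuous (fun t => P (g (X - B1 t))) t).
    { apply (continuous_comp (fun t => g (X - B1 t)) P); [|apply cP].
      eapply is_derive_cont, Hg. }
    apply (continuous_plus (V := R_NormedModule)); [|apply cQ].
    apply (continuous_mult (K := R_AbsRing)); [now apply (continuous_mult (K := R_AbsRing))|].
    now apply continuous_Rinv.
  + intros t; specialize (BPQ (g (X - B1 t)) t); unfold h'.
    set (p := P (g (X - B1 t))) in *; specialize (Q0 t).
    assert (Q2 : 0 < Q t * Q t) by now apply Rsqr_pos_lt.
    replace ((p * p * / Q t + Q t) ^ 2) with ((p ^ 2 + Q t ^ 2) ^ 2 / (Q t * Q t))
      by (field; exact Q0).
    apply Rmult_le_reg_r with (Q t * Q t * M); [now apply Rmult_lt_0_compat|].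
    replace (/ M * (Q t * Q t * M)) with (Q t ^ 2) by (field; lra).
    replace ((p ^ 2 + Q t ^ 2) ^ 2 / (Q t * Q t) * (Q t * Q t * M))
      with (M * (p ^ 2 + Q t ^ 2) ^ 2) by (field; exact Q0).
    exact BPQ.
  + exists (g (X - B1 t)), t; split; [rewrite G2; ring|exact Ht].
Qed.

(** The angle condition with [x = P^2] and [y = Q^2]: a large [x] bounds [y] from
    above, and a small [x] bounds [y] from below. *)
Lemma angle_bound_high x y c :
  0 < x -> 0 < y -> 0 < c -> c^2 * (x^2 + 1) * (y^2 + 1) <= (x + y)^2 ->
  2 / c <= x -> y <= 2 / c.
Proof.
intros Hx Hy Hc H Hb.
assert (E : c * (2 / c) = 2) by (field; lra).
assert (K : c * x * y <= x + y).
{ apply Rsqr_incr_0_var; unfold Rsqr; [|lra].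
  assert (0 <= c^2 * (x^2 + y^2 + 1)) by (apply Rmult_le_pos; nra).
  nra. }
assert (c * x >= 2) by nra.
apply Rmult_le_reg_l with c; [exact Hc|]; rewrite E.
apply Rnot_lt_le; intros C.
nra.
Qed.

Lemma angle_bound_low x y c :
  0 < x -> 0 < y -> 0 < c -> c^2 * (x^2 + 1) * (y^2 + 1) <= (x + y)^2 ->
  x <= c / 2 -> c / 2 <= y.
Proof.
intros Hx Hy Hc H Hb.
enough (c <= x + y) by lra.
apply Rsqr_incr_0_var; unfold Rsqr; [|lra].
assert (0 <= c^2 * (x^2 + y^2 + x^2 * y^2)) by (apply Rmult_le_pos; nra).
nra.
Qed.

Lemma null_onto_of_angle_bound P Q A1 A2 B1 B2 c :
  null_data P Q A1 A2 B1 B2 -> 0 < c ->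
  (forall s t, c^2 * ((P s ^ 2)^2 + 1) * ((Q t ^ 2)^2 + 1) <= (P s ^ 2 + Q t ^ 2)^2) ->
  null_onto A1 A2 B1 B2.
Proof.
intros ND Hc HB; pose proof ND as [cP [cQ [P0 [Q0 [HA1 [HA2 [HB1 HB2]]]]]]].
assert (Px : forall s, 0 < P s ^ 2)
  by (intros s; simpl; rewrite Rmult_1_r; apply Rsqr_pos_lt, P0).
assert (Qx : forall t, 0 < Q t ^ 2)
  by (intros t; simpl; rewrite Rmult_1_r; apply Rsqr_pos_lt, Q0).
assert (M0 : 0 < 2 / c) by (apply Rdiv_lt_0_compat; lra).
assert (E : c / 2 * (2 / c) = 1) by (field; lra).
assert (c2 : 0 < c / 2) by lra.
(* lower bound for the derivative of Y along the level sets of X *)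
assert (low : forall x y, 0 < x -> 0 < y -> c / 2 <= y \/ c / 2 <= x ->
  y <= 2 / c * (x + y) ^ 2).
{ intros x y Hx Hy [L|L].
  - apply Rle_trans with (2 / c * (c / 2 * y)); [nra|].
    apply Rmult_le_compat_l; [lra|nra].
  - apply Rle_trans with (2 / c * (c / 2 * y)); [nra|].
    apply Rmult_le_compat_l; [lra|nra]. }
assert (hi : forall x, 0 < x -> c / 2 <= x -> / x <= 2 / c).
{ intros x Hx L; replace (2 / c) with (/ (c / 2)) by (field; lra).
  now apply Rinv_le_contravar. }
assert (lo : forall x, 0 < x -> x <= 2 / c -> c / 2 <= / x).
{ intros x Hx L; replace (c / 2) with (/ (2 / c)) by (field; lra).
  now apply Rinv_le_contravar. }
assert (sym : forall s t,
  c^2 * ((Q t ^ 2)^2 + 1) * ((P s ^ 2)^2 + 1) <= (Q t ^ 2 + P s ^ 2)^2).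
{ intros s t; generalize (HB s t); intros H.
  replace (c^2 * ((Q t ^ 2)^2 + 1) * ((P s ^ 2)^2 + 1))
    with (c^2 * ((P s ^ 2)^2 + 1) * ((Q t ^ 2)^2 + 1)) by ring.
  now rewrite (Rplus_comm (Q t ^ 2)). }
destruct (classic (forall s, P s ^ 2 <= 2 / c)) as [U|U].
- apply (null_onto_of_bounded P Q A1 A2 B1 B2 (2 / c) ND M0 U).
  intros s t; apply low; [apply Px|apply Qx|].
  destruct (Rle_dec (c / 2) (P s ^ 2)) as [L|L]; [now right|left].
  apply (angle_bound_low (P s ^ 2)); auto; lra.
- assert (QU : forall t, Q t ^ 2 <= 2 / c).
  { apply not_all_ex_not in U as [s Hs]; intros t.
    apply (angle_bound_high (P s ^ 2)); auto; lra. }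
  destruct (classic (forall s, c / 2 <= P s ^ 2)) as [L|L].
  + (* P^2 >= c/2 and Q^2 <= 2/c: replacing P, Q by - 1/P, 1/Q exchanges X and Y *)
    intros X Y.
    destruct (null_onto_of_bounded (fun s => - / P s) (fun t => / Q t)
      (fun s => - A2 s) (fun s => - A1 s) B2 B1 (2 / c)) with Y X
      as [s [t [H1 H2]]].
    * split; [|split; [|split; [|split; [|split; [|split; [|split]]]]]].
      -- intros s; apply (continuous_opp (V := R_NormedModule)).
         now apply continuous_Rinv.
      -- intros; now apply continuous_Rinv.
      -- intros s; apply Ropp_neq_0_compat, Rinv_neq_0_compat, P0.
      -- intros t; apply Rinv_neq_0_compat, Q0.
      -- intros s; rewrite Rinv_opp, Rinv_inv.
         apply (is_derive_opp (V := R_NormedModule)), HA2.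
      -- intros s; apply (is_derive_opp (V := R_NormedModule)), HA1.
      -- intros t; rewrite Rinv_inv; apply HB2.
      -- exact HB1.
    * exact M0.
    * intros s; replace ((- / P s)^2) with (/ (P s ^ 2)) by (field; apply P0).
      apply hi; auto.
    * intros s t; replace ((- / P s)^2) with (/ (P s ^ 2)) by (field; apply P0).
      rewrite pow_inv; apply low; try (apply Rinv_0_lt_compat; auto).
      left; apply lo; auto.
    * exists s, t; split; [rewrite <- H2; ring|rewrite <- H1; ring].
  + assert (QL : forall t, c / 2 <= Q t ^ 2).
    { apply not_all_ex_not in L as [s Hs]; intros t.
      apply (angle_bound_low (P s ^ 2)); auto; lra. }
    (* P^2 takes values above 2/c and below c/2, so Q^2 is bounded above and
       below: exchange the roles of s and t *)
    intros X Y.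
    destruct (null_onto_of_bounded Q P B1 B2 A1 A2 (2 / c)) with X (- Y)
      as [t [s [H1 H2]]]; auto.
    * unfold null_data; tauto.
    * exists s, t; split; lra.
Qed.

(** ** The inverse of the null coordinates *)

Lemma increments_same_sign A1 A2 P :
  (forall s : R, continuous P s) -> (forall s, P s <> 0) ->
  (forall s : R, is_derive A1 s (/ P s)) -> (forall s : R, is_derive A2 s (P s)) ->
  forall s0 s, 0 <= (A1 s - A1 s0) * (A2 s - A2 s0).
Proof.
intros cP P0 H1 H2 s0 s.
destruct (MVT_R A1 _ s0 s H1) as [a ->]; destruct (MVT_R A2 _ s0 s H2) as [b ->].
replace (/ P a * (s - s0) * (P b * (s - s0)))
  with (/ P a * P b * ((s - s0) * (s - s0))) by ring.
apply Rmult_le_pos; [|apply Rle_0_sqr].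
destruct (nonvanishing_sign P cP P0) as [S|S];
  pose proof (S a) as Sa; pose proof (S b) as Sb; apply Rlt_le.
- apply Rmult_lt_0_compat; [now apply Rinv_0_lt_compat|exact Sb].
- apply Rmult_neg_neg; [now apply Rinv_lt_0_compat|exact Sb].
Qed.

(** Null coordinates are injective with continuous inverse: of the two pairs of
    increments making up those of [X] and of [Y], one has no cancellation. *)
Lemma null_separates P Q A1 A2 B1 B2 :
  null_data P Q A1 A2 B1 B2 ->
  forall s0 t0 eps, 0 < eps -> exists eta, 0 < eta /\ forall s t,
    Rabs ((A1 s + B1 t) - (A1 s0 + B1 t0)) < eta ->
    Rabs ((- A2 s + B2 t) - (- A2 s0 + B2 t0)) < eta ->
    Rabs (s - s0) < eps /\ Rabs (t - t0) < eps.
Proof.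
intros [cP [cQ [P0 [Q0 [HA1 [HA2 [HB1 HB2]]]]]]] s0 t0 eps He.
assert (iP : forall s, continuous (fun s => / P s) s) by (intros; now apply continuous_Rinv).
assert (iQ : forall s, continuous (fun s => / Q s) s) by (intros; now apply continuous_Rinv).
assert (iP0 : forall s, / P s <> 0) by (intros; now apply Rinv_neq_0_compat).
assert (iQ0 : forall s, / Q s <> 0) by (intros; now apply Rinv_neq_0_compat).
destruct (nonvanishing_separates A1 _ HA1 iP iP0 s0 eps He) as [e1 [E1 F1]].
destruct (nonvanishing_separates A2 _ HA2 cP P0 s0 eps He) as [e2 [E2 F2]].
destruct (nonvanishing_separates B1 _ HB1 iQ iQ0 t0 eps He) as [e3 [E3 F3]].
destruct (nonvanishing_separates B2 _ HB2 cQ Q0 t0 eps He) as [e4 [E4 F4]].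
exists (Rmin (Rmin e1 e2) (Rmin e3 e4)); split.
{ repeat apply Rmin_glb_lt; assumption. }
intros s t HX HY.
pose proof (increments_same_sign A1 A2 P cP P0 HA1 HA2 s0 s) as SA.
pose proof (increments_same_sign B1 B2 Q cQ Q0 HB1 HB2 t0 t) as SB.
pose proof (Rmin_l (Rmin e1 e2) (Rmin e3 e4)); pose proof (Rmin_r (Rmin e1 e2) (Rmin e3 e4)).
pose proof (Rmin_l e1 e2); pose proof (Rmin_r e1 e2).
pose proof (Rmin_l e3 e4); pose proof (Rmin_r e3 e4).
set (eta := Rmin (Rmin e1 e2) (Rmin e3 e4)) in *.
set (a := A1 s - A1 s0) in *; set (a' := A2 s - A2 s0) in *.
set (b := B1 t - B1 t0) in *; set (b' := B2 t - B2 t0) in *.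
replace (A1 s + B1 t - (A1 s0 + B1 t0)) with (a + b) in HX by (unfold a, b; ring).
replace (- A2 s + B2 t - (- A2 s0 + B2 t0)) with (b' - a') in HY
  by (unfold a', b'; ring).
assert (K : forall x y e, 0 <= x * y -> Rabs (x + y) < e -> Rabs x < e /\ Rabs y < e).
{ intros x y e Hxy Hs; apply Rabs_def2 in Hs as [S1 S2].
  destruct (Rle_lt_dec 0 x), (Rle_lt_dec 0 y); split; apply Rabs_def1; nra. }
destruct (Rle_lt_dec 0 (a * b)) as [Hab|Hab].
- destruct (K a b eta Hab HX) as [K1 K2]; split; [apply F1|apply F3]; fold a b; lra.
- assert (Hab' : 0 <= b' * - a').
  { apply Rnot_lt_le; intros C.
    pose proof (Rmult_le_pos _ _ SA SB).
    pose proof (Rmult_lt_0_compat (- (a * b)) (- (b' * - a')) ltac:(lra) ltac:(lra)).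
    lra. }
  destruct (K b' (- a') eta Hab' HY) as [K1 K2]; rewrite Rabs_Ropp in K2.
  split; [apply F2|apply F4]; fold a' b'; lra.
Qed.

Lemma null_injective P Q A1 A2 B1 B2 :
  null_data P Q A1 A2 B1 B2 -> forall s t s0 t0,
  A1 s + B1 t = A1 s0 + B1 t0 -> - A2 s + B2 t = - A2 s0 + B2 t0 ->
  s = s0 /\ t = t0.
Proof.
intros ND s t s0 t0 HX HY.
assert (K : forall eps, 0 < eps -> Rabs (s - s0) < eps /\ Rabs (t - t0) < eps).
{ intros eps He; destruct (null_separates _ _ _ _ _ _ ND s0 t0 eps He) as [eta [E F]].
  apply F; [rewrite HX|rewrite HY]; rewrite Rminus_diag, Rabs_R0; exact E. }
split; apply Rminus_diag_uniq, NNPP; intros N; apply Rabs_pos_lt in N;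
  destruct (K _ N) as [K1 K2]; lra.
Qed.

(** A curve that is affine in null coordinates is differentiable: its velocity
    solves the linear system given by the differentials of [X] and [Y]. *)
Lemma null_line_derive P Q A1 A2 B1 B2 S T p q p' q' :
  null_data P Q A1 A2 B1 B2 ->
  (forall r, A1 (S r) + B1 (T r) = p * r + q) ->
  (forall r, - A2 (S r) + B2 (T r) = p' * r + q') ->
  forall r,
  is_derive S r ((p * Q (T r) - p' * / Q (T r))
                 / (Q (T r) * / P (S r) + P (S r) * / Q (T r))) /\
  is_derive T r ((p * P (S r) + p' * / P (S r))
                 / (Q (T r) * / P (S r) + P (S r) * / Q (T r))).
Proof.
intros ND HX HY r.
assert (C : forall eps, 0 < eps -> exists d, 0 < d /\ forall x, Rabs (x - r) < d ->
  Rabs (S x - S r) < eps /\ Rabs (T x - T r) < eps).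
{ intros eps He.
  destruct (null_separates _ _ _ _ _ _ ND (S r) (T r) eps He) as [eta [E F]].
  set (m := Rabs p + Rabs p' + 1).
  assert (m1 : 1 <= m) by (unfold m; pose proof (Rabs_pos p); pose proof (Rabs_pos p'); lra).
  exists (eta / m); split; [apply Rdiv_lt_0_compat; lra|].
  intros x Hx; assert (Hx' : Rabs (x - r) * m < eta).
  { apply Rmult_lt_reg_r with (/ m); [apply Rinv_0_lt_compat; lra|].
    rewrite Rmult_assoc, Rinv_r; [lra|lra]. }
  pose proof (Rmult_le_pos _ _ (Rabs_pos p) (Rabs_pos (x - r))).
  pose proof (Rmult_le_pos _ _ (Rabs_pos p') (Rabs_pos (x - r))).
  pose proof (Rabs_pos (x - r)); unfold m in Hx'.
  apply F; rewrite ?HX, ?HY.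
  - replace (p * x + q - (p * r + q)) with (p * (x - r)) by ring.
    rewrite Rabs_mult; lra.
  - replace (p' * x + q' - (p' * r + q')) with (p' * (x - r)) by ring.
    rewrite Rabs_mult; lra. }
assert (CS : continuous S r).
{ apply continuity_pt_filterlim; intros eps He; destruct (C eps He) as [d [D1 D2]].
  exists d; split; [exact D1|]; intros x [_ Hx]; apply D2, Hx. }
assert (CT : continuous T r).
{ apply continuity_pt_filterlim; intros eps He; destruct (C eps He) as [d [D1 D2]].
  exists d; split; [exact D1|]; intros x [_ Hx]; apply D2, Hx. }
destruct ND as [cP [cQ [P0 [Q0 [HA1 [HA2 [HB1 HB2]]]]]]].
destruct (global_slope A1 _ (S r) HA1) as [a1 [a1c [a1v [a1e a1s]]]].
destruct (global_slope A2 _ (S r) HA2) as [a2 [a2c [a2v [a2e a2s]]]].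
destruct (global_slope B1 _ (T r) HB1) as [b1 [b1c [b1v [b1e b1s]]]].
destruct (global_slope B2 _ (T r) HB2) as [b2 [b2c [b2v [b2e b2s]]]].
set (D := fun x => b2 (T x) * a1 (S x) + a2 (S x) * b1 (T x)).
assert (D0 : forall x, D x <> 0).
{ intros x; unfold D.
  destruct (a1s (S x)) as [c1 ->], (a2s (S x)) as [c2 ->],
    (b1s (T x)) as [c3 ->], (b2s (T x)) as [c4 ->].
  assert (IP : 0 < P c1 -> 0 < / P c1) by apply Rinv_0_lt_compat.
  assert (IP' : P c1 < 0 -> / P c1 < 0) by apply Rinv_lt_0_compat.
  assert (IQ : 0 < Q c3 -> 0 < / Q c3) by apply Rinv_0_lt_compat.
  assert (IQ' : Q c3 < 0 -> / Q c3 < 0) by apply Rinv_lt_0_compat.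
  destruct (nonvanishing_sign P cP P0) as [S1|S1];
    pose proof (S1 c1) as U1; pose proof (S1 c2) as U2;
    destruct (nonvanishing_sign Q cQ Q0) as [S2|S2];
    pose proof (S2 c3) as U3; pose proof (S2 c4) as U4;
    [specialize (IP U1); specialize (IQ U3)|specialize (IP U1); specialize (IQ' U3)
    |specialize (IP' U1); specialize (IQ U3)|specialize (IP' U1); specialize (IQ' U3)];
    nra. }
assert (cS : forall f : R -> R, continuous f (S r) -> continuous (fun x => f (S x)) r)
  by (intros; now apply (continuous_comp S f)).
assert (cT : forall f : R -> R, continuous f (T r) -> continuous (fun x => f (T x)) r)
  by (intros; now apply (continuous_comp T f)).
assert (cD : continuous (fun x => / D x) r).
{ apply continuous_Rinv; [|apply D0].
  apply (continuous_plus (V := R_NormedModule));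
    apply (continuous_mult (K := R_AbsRing)); auto. }
assert (eX : forall x, a1 (S x) * (S x - S r) + b1 (T x) * (T x - T r) = p * (x - r)).
{ intros x; rewrite <- a1e, <- b1e; generalize (HX x) (HX r); lra. }
assert (eY : forall x, - a2 (S x) * (S x - S r) + b2 (T x) * (T x - T r) = p' * (x - r)).
{ intros x; generalize (a2e (S x)) (b2e (T x)) (HY x) (HY r); lra. }
rewrite <- a1v, <- a2v, <- b1v, <- b2v; fold (D r); split.
- apply (slope_is_derive S r (fun x => (p * b2 (T x) - p' * b1 (T x)) / D x)).
  + apply (continuous_mult (K := R_AbsRing)); [|exact cD].
    apply (continuous_minus (V := R_NormedModule));
      apply (continuous_mult (K := R_AbsRing)); auto; apply continuous_const.
  + intros x; apply Rmult_eq_reg_r with (D x); [|apply D0].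
    replace ((p * b2 (T x) - p' * b1 (T x)) / D x * (x - r) * D x)
      with (b2 (T x) * (p * (x - r)) - b1 (T x) * (p' * (x - r)))
      by (field; apply D0).
    rewrite <- eX, <- eY; unfold D; ring.
- apply (slope_is_derive T r (fun x => (p * a2 (S x) + p' * a1 (S x)) / D x)).
  + apply (continuous_mult (K := R_AbsRing)); [|exact cD].
    apply (continuous_plus (V := R_NormedModule));
      apply (continuous_mult (K := R_AbsRing)); auto; apply continuous_const.
  + intros x; apply Rmult_eq_reg_r with (D x); [|apply D0].
    replace ((p * a2 (S x) + p' * a1 (S x)) / D x * (x - r) * D x)
      with (a2 (S x) * (p * (x - r)) + a1 (S x) * (p' * (x - r)))
      by (field; apply D0).
    rewrite <- eX, <- eY; unfold D; ring.
Qed.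

(** The velocity is a smooth function of the position, so that regularity
    propagates by induction on the order. *)
Lemma null_line_smooth P Q A1 A2 B1 B2 S T p q p' q' :
  null_data P Q A1 A2 B1 B2 -> smooth P -> smooth Q ->
  (forall r, A1 (S r) + B1 (T r) = p * r + q) ->
  (forall r, - A2 (S r) + B2 (T r) = p' * r + q') ->
  smooth S /\ smooth T.
Proof.
intros ND sP sQ HX HY.
pose proof (null_line_derive _ _ _ _ _ _ _ _ _ _ _ _ ND HX HY) as H.
destruct ND as [_ [_ [P0 [Q0 _]]]].
rewrite smooth_Ck in sP, sQ; rewrite !smooth_Ck.
enough (K : forall n, Ck n allR S /\ Ck n allR T) by (split; intros n; apply K).
induction n as [|n [IS IT]]; [split; exact I|].
assert (D0 : forall r, Q (T r) * / P (S r) + P (S r) * / Q (T r) <> 0).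
{ intros r E; specialize (P0 (S r)); specialize (Q0 (T r)).
  assert (0 < P (S r) * P (S r)) by now apply Rsqr_pos_lt.
  assert (0 < Q (T r) * Q (T r)) by now apply Rsqr_pos_lt.
  apply (Rmult_eq_compat_r (P (S r) * Q (T r))) in E; field_simplify in E; lra. }
assert (KP : Ck n allR (fun r => P (S r)))
  by (apply (Ck_comp n allR allR P S); unfold allR; auto).
assert (KQ : Ck n allR (fun r => Q (T r)))
  by (apply (Ck_comp n allR allR Q T); unfold allR; auto).
assert (KP' : Ck n allR (fun r => / P (S r))) by (apply Ck_inv; auto).
assert (KQ' : Ck n allR (fun r => / Q (T r))) by (apply Ck_inv; auto).
assert (KD : Ck n allR (fun r => Q (T r) * / P (S r) + P (S r) * / Q (T r)))
  by (apply Ck_plus; apply Ck_mult; assumption).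
split.
- exists (fun r => (p * Q (T r) - p' * / Q (T r))
                   / (Q (T r) * / P (S r) + P (S r) * / Q (T r))).
  split; [intros r _; apply H|apply Ck_div; [auto| |exact KD]].
  apply Ck_minus; (apply Ck_mult; [apply Ck_const|assumption]).
- exists (fun r => (p * P (S r) + p' * / P (S r))
                   / (Q (T r) * / P (S r) + P (S r) * / Q (T r))).
  split; [intros r _; apply H|apply Ck_div; [auto| |exact KD]].
  apply Ck_plus; (apply Ck_mult; [apply Ck_const|assumption]).
Qed.

(** * The metric in the null frame *)

(** The metric [(- P ds + Q dt) (ds / P + dt / Q)]. *)
Definition null_metric (P Q : R -> R) : metric := fun i j s t =>
  match i, j with
  | axS, axS => -1
  | axT, axT => 1
  | _, _ => (Q t / P s - P s / Q t) / 2
  end.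

(** Its Christoffel symbols, in terms of [P], [Q] and their derivatives. *)
Definition null_christoffel (P P1 Q Q1 : R -> R) (k i j : axis) (s t : R) : R :=
  match k, i, j with
  | axS, axS, axS => - (P1 s / P s * (Q t ^ 2 - P s ^ 2) / (P s ^ 2 + Q t ^ 2))
  | axT, axS, axS => - (2 * P1 s * Q t / (P s ^ 2 + Q t ^ 2))
  | axS, axT, axT => - (2 * P s * Q1 t / (P s ^ 2 + Q t ^ 2))
  | axT, axT, axT => Q1 t / Q t * (Q t ^ 2 - P s ^ 2) / (P s ^ 2 + Q t ^ 2)
  | _, _, _ => 0
  end.

Lemma sum_sqr_neq_0 x y : x <> 0 -> x ^ 2 + y ^ 2 <> 0.
Proof.
intros H; assert (0 < x * x) by now apply Rsqr_pos_lt.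
pose proof (Rle_0_sqr y); unfold Rsqr in *; simpl; lra.
Qed.

Lemma christoffel_null_metric P P1 Q Q1 k i j :
  (forall s : R, is_derive P s (P1 s)) -> (forall t : R, is_derive Q t (Q1 t)) ->
  (forall s, P s <> 0) -> (forall t, Q t <> 0) ->
  christoffel (null_metric P Q) k i j = null_christoffel P P1 Q Q1 k i j.
Proof.
intros HP HQ P0 Q0.
apply functional_extensionality; intros s; apply functional_extensionality; intros t.
assert (D1 : Derive (fun r => (Q t / P r - P r / Q t) / 2) s
             = - P1 s * (Q t / P s ^ 2 + / Q t) / 2).
{ apply is_derive_unique; auto_derive.
  - repeat split; auto; now exists (P1 s).
  - replace (Derive (fun x => P x) s) with (P1 s)
      by (symmetry; apply is_derive_unique, HP); field; auto. }
assert (D2 : Derive (fun r => (Q r / P s - P s / Q r) / 2) t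
             = Q1 t * (P s / Q t ^ 2 + / P s) / 2).
{ apply is_derive_unique; auto_derive.
  - repeat split; auto; now exists (Q1 t).
  - replace (Derive (fun x => Q x) t) with (Q1 t)
      by (symmetry; apply is_derive_unique, HQ); field; auto. }
pose proof (sum_sqr_neq_0 (P s) (Q t) (P0 s)) as W.
unfold christoffel, sum_axis.
destruct k, i, j; unfold ginv, gdet; cbn [partial null_metric null_christoffel axis_eqb other];
  rewrite ?Derive_const, ?D1, ?D2; try field; repeat split; auto;
  intros E; apply W, Rsqr_0_uniq; unfold Rsqr; lra.
Qed.

Lemma null_metric_flat P P1 P2 Q Q1 Q2 :
  (forall s : R, is_derive P s (P1 s)) -> (forall t : R, is_derive Q t (Q1 t)) ->
  (forall s : R, is_derive P1 s (P2 s)) -> (forall t : R, is_derive Q1 t (Q2 t)) ->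
  (forall s, P s <> 0) -> (forall t, Q t <> 0) ->
  flat (null_metric P Q).
Proof.
intros HP HQ HP1 HQ1 P0 Q0.
assert (C : forall k i j, christoffel (null_metric P Q) k i j
                          = null_christoffel P P1 Q Q1 k i j)
  by (intros; now apply christoffel_null_metric).
intros l k i j s t; unfold riemann, sum_axis; rewrite !C; clear C.
pose proof (sum_sqr_neq_0 (P s) (Q t) (P0 s)) as W.
assert (eP : Derive (fun x => P x) s = P1 s) by apply is_derive_unique, HP.
assert (eQ : Derive (fun x => Q x) t = Q1 t) by apply is_derive_unique, HQ.
assert (eP1 : Derive (fun x => P1 x) s = P2 s) by apply is_derive_unique, HP1.
assert (eQ1 : Derive (fun x => Q1 x) t = Q2 t) by apply is_derive_unique, HQ1.
assert (xP : ex_derive P s) by now exists (P1 s).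
assert (xQ : ex_derive Q t) by now exists (Q1 t).
assert (xP1 : ex_derive P1 s) by now exists (P2 s).
assert (xQ1 : ex_derive Q1 t) by now exists (Q2 t).
assert (W' : P s * (P s * 1) + Q t * (Q t * 1) <> 0) by exact W.
(* derivatives of the four nonzero symbols in the direction entering the
   curvature *)
assert (d1 : Derive (fun r => - (P1 s / P s * (Q r ^ 2 - P s ^ 2) / (P s ^ 2 + Q r ^ 2))) t
  = - (4 * P s * P1 s * Q t * Q1 t / (P s ^ 2 + Q t ^ 2) ^ 2)).
{ apply is_derive_unique; auto_derive; [tauto|].
  rewrite eQ; field; auto. }
assert (d2 : Derive (fun r => - (2 * P1 s * Q r / (P s ^ 2 + Q r ^ 2))) t
  = - (2 * P1 s * Q1 t * (P s ^ 2 - Q t ^ 2) / (P s ^ 2 + Q t ^ 2) ^ 2)).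
{ apply is_derive_unique; auto_derive; [tauto|].
  rewrite eQ; field; auto. }
assert (d3 : Derive (fun r => - (2 * P r * Q1 t / (P r ^ 2 + Q t ^ 2))) s
  = - (2 * Q1 t * P1 s * (Q t ^ 2 - P s ^ 2) / (P s ^ 2 + Q t ^ 2) ^ 2)).
{ apply is_derive_unique; auto_derive; [tauto|].
  rewrite eP; field; auto. }
assert (d4 : Derive (fun r => Q1 t / Q t * (Q t ^ 2 - P r ^ 2) / (P r ^ 2 + Q t ^ 2)) s
  = - (4 * P s * P1 s * Q t * Q1 t / (P s ^ 2 + Q t ^ 2) ^ 2)).
{ apply is_derive_unique; auto_derive; [tauto|].
  rewrite eP; field; auto. }
destruct l, k, i, j; cbn [partial null_christoffel];
  rewrite ?Derive_const, ?d1, ?d2, ?d3, ?d4; try ring; field; auto.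
Qed.

Lemma null_metric_lorentzian P Q : lorentzian (null_metric P Q).
Proof.
intros s t; set (F := (Q t / P s - P s / Q t) / 2).
assert (N : 0 < 1 + F ^ 2) by nra.
assert (H : sqrt (1 + F ^ 2) * sqrt (1 + F ^ 2) = 1 + F ^ 2) by (apply sqrt_sqrt; lra).
pose proof (sqrt_lt_R0 _ N) as N'.
exists (fun i => match i with axS => 1 | axT => 0 end).
exists (fun i => match i with axS => F / sqrt (1 + F ^ 2) | axT => 1 / sqrt (1 + F ^ 2) end).
unfold metric_eval, sum_axis; cbn [null_metric]; fold F.
split; [ring|split; [|field; lra]].
transitivity ((1 + F ^ 2) / (sqrt (1 + F ^ 2) * sqrt (1 + F ^ 2))).
- field; lra.
- rewrite H; field; lra.
Qed.

(** ** Geodesics are affine in null coordinates *)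

(** At a point with velocity [(S1, T1)] and acceleration [(S2, T2)], the second
    derivatives of [X] and [Y] are the values of [dX] and [dY] on the vector
    [geo] whose vanishing is the geodesic equation. *)
Lemma geodesic_null_equations P P1 Q Q1 s t S1 T1 S2 T2 :
  P s <> 0 -> Q t <> 0 ->
  let geo k := match k with axS => S2 | axT => T2 end +
    sum_axis (fun i => sum_axis (fun j => null_christoffel P P1 Q Q1 k i j s t
      * match i with axS => S1 | axT => T1 end
      * match j with axS => S1 | axT => T1 end)) in
  S2 / P s - P1 s * S1 ^ 2 / P s ^ 2 + (T2 / Q t - Q1 t * T1 ^ 2 / Q t ^ 2)
    = geo axS / P s + geo axT / Q t /\
  - (S2 * P s + P1 s * S1 ^ 2) + (T2 * Q t + Q1 t * T1 ^ 2)
    = - (P s * geo axS) + Q t * geo axT.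
Proof.
intros P0 Q0 geo; pose proof (sum_sqr_neq_0 (P s) (Q t) P0) as W.
unfold geo, sum_axis; cbn [null_christoffel]; split; field; auto.
Qed.

Lemma Rbar_between (a b : Rbar) (x y z : R) :
  Rbar_lt a x -> Rbar_lt x b -> Rbar_lt a y -> Rbar_lt y b ->
  Rmin x y <= z <= Rmax x y -> Rbar_lt a z /\ Rbar_lt z b.
Proof.
intros H1 H2 H3 H4 [L U]; split.
- apply Rbar_lt_le_trans with (Rmin x y); [|exact L].
  unfold Rmin; destruct (Rle_dec x y); assumption.
- apply Rbar_le_lt_trans with (Rmax x y); [exact U|].
  unfold Rmax; destruct (Rle_dec x y); assumption.
Qed.

Lemma Rbar_interval_inhabited (a b : Rbar) :
  Rbar_lt a b -> exists r : R, Rbar_lt a r /\ Rbar_lt r b.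
Proof.
destruct a as [a| |], b as [b| |]; simpl; intros H; try contradiction.
- exists ((a + b) / 2); simpl; lra.
- exists (a + 1); simpl; split; [lra|exact I].
- exists (b - 1); simpl; split; [exact I|lra].
- now exists 0.
Qed.

Lemma MVT_interval (a b : Rbar) (f f1 : R -> R) :
  (forall r : R, Rbar_lt a r -> Rbar_lt r b -> is_derive f r (f1 r)) ->
  forall x y : R, Rbar_lt a x -> Rbar_lt x b -> Rbar_lt a y -> Rbar_lt y b ->
  exists c : R, Rbar_lt a c /\ Rbar_lt c b /\ f y - f x = f1 c * (y - x).
Proof.
intros H x y Hx1 Hx2 Hy1 Hy2.
destruct (MVT_gen f x y f1) as [c [Hc1 Hc2]].
- intros z Hz; destruct (Rbar_between a b x y z); auto; lra.
- intros z Hz; destruct (Rbar_between a b x y z); auto.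
  apply continuity_pt_filterlim, is_derive_cont with (f1 z); auto.
- exists c; destruct (Rbar_between a b x y c); auto.
Qed.

Lemma affine_of_second_derivative_zero (a b : Rbar) (f f1 : R -> R) :
  (forall r : R, Rbar_lt a r -> Rbar_lt r b -> is_derive f r (f1 r)) ->
  (forall r : R, Rbar_lt a r -> Rbar_lt r b -> is_derive f1 r 0) ->
  forall r0 r : R, Rbar_lt a r0 -> Rbar_lt r0 b -> Rbar_lt a r -> Rbar_lt r b ->
  f r = f1 r0 * r + (f r0 - f1 r0 * r0).
Proof.
intros H H1 r0 r A0 B0 A B.
destruct (MVT_interval a b f f1 H r0 r A0 B0 A B) as [c [A' [B' E]]].
destruct (MVT_interval a b f1 (fun _ => 0) H1 r0 c A0 B0 A' B') as [d [_ [_ E']]].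
replace (f1 c) with (f1 r0) in E by lra; lra.
Qed.

Lemma smooth_at_is_derive f r : smooth_at f r -> is_derive f r (Derive f r).
Proof. intros H; apply Derive_correct; exact (H 1%nat). Qed.

Lemma smooth_at_is_derive2 f r :
  smooth_at f r -> is_derive (Derive f) r (Derive_n f 2 r).
Proof. intros H; apply (Derive_correct (Derive_n f 1)); exact (H 2%nat). Qed.

(** First derivative of [A s + B t] along a curve, where [A' = p] and [B' = q]. *)
Lemma derive_sum_comp (A B p q S T : R -> R) r :
  (forall s : R, is_derive A s (p s)) -> (forall t : R, is_derive B t (q t)) ->
  smooth_at S r -> smooth_at T r ->
  is_derive (fun r => A (S r) + B (T r)) r (Derive S r * p (S r) + Derive T r * q (T r)).
Proof.
intros HA HB HS HT.
apply (is_derive_plus (V := R_NormedModule)).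
- apply (is_derive_comp A S); [apply HA|now apply smooth_at_is_derive].
- apply (is_derive_comp B T); [apply HB|now apply smooth_at_is_derive].
Qed.

(** Its second derivative. *)
Lemma derive2_sum_comp (p q p1 q1 S T : R -> R) r :
  is_derive p (S r) (p1 (S r)) -> is_derive q (T r) (q1 (T r)) ->
  smooth_at S r -> smooth_at T r ->
  is_derive (fun r => Derive S r * p (S r) + Derive T r * q (T r)) r
    (Derive_n S 2 r * p (S r) + Derive S r * (Derive S r * p1 (S r)) +
     (Derive_n T 2 r * q (T r) + Derive T r * (Derive T r * q1 (T r)))).
Proof.
intros Hp Hq HS HT.
apply (is_derive_plus (V := R_NormedModule)).
- apply (is_derive_mult (Derive S) (fun r => p (S r)) r); [| |intros; apply Rmult_comm].
  + now apply smooth_at_is_derive2.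
  + apply (is_derive_comp p S); [exact Hp|now apply smooth_at_is_derive].
- apply (is_derive_mult (Derive T) (fun r => q (T r)) r); [| |intros; apply Rmult_comm].
  + now apply smooth_at_is_derive2.
  + apply (is_derive_comp q T); [exact Hq|now apply smooth_at_is_derive].
Qed.

Lemma is_derive_inv_neq (P : R -> R) s p1 :
  is_derive P s p1 -> P s <> 0 -> is_derive (fun x => / P x) s (- p1 / P s ^ 2).
Proof. intros H H0; exact (is_derive_inv P s p1 H H0). Qed.

(** The two components of the geodesic equation of a null metric, are equivalent
    to [X'' = 0] and [Y'' = 0]. *)
Lemma geodesic_iff_affine P P1 Q Q1 (gam : axis -> R -> R) r :
  (forall s : R, is_derive P s (P1 s)) -> (forall t : R, is_derive Q t (Q1 t)) ->
  (forall s, P s <> 0) -> (forall t, Q t <> 0) ->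
  let S := gam axS in let T := gam axT in
  (forall k, Derive_n (gam k) 2 r +
     sum_axis (fun i => sum_axis (fun j =>
       christoffel (null_metric P Q) k i j (S r) (T r)
       * Derive (gam i) r * Derive (gam j) r)) = 0) <->
  (Derive_n S 2 r * / P (S r) + Derive S r * (Derive S r * (- P1 (S r) / P (S r) ^ 2)) +
    (Derive_n T 2 r * / Q (T r) + Derive T r * (Derive T r * (- Q1 (T r) / Q (T r) ^ 2)))
   = 0 /\
   Derive_n S 2 r * - P (S r) + Derive S r * (Derive S r * - P1 (S r)) +
    (Derive_n T 2 r * Q (T r) + Derive T r * (Derive T r * Q1 (T r))) = 0).
Proof.
intros HP HQ P0 Q0 S T.
pose proof (P0 (S r)) as P0'; pose proof (Q0 (T r)) as Q0'.
pose proof (sum_sqr_neq_0 (P (S r)) (Q (T r)) P0') as W.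
destruct (geodesic_null_equations P P1 Q Q1 (S r) (T r) (Derive S r) (Derive T r)
  (Derive_n S 2 r) (Derive_n T 2 r) P0' Q0') as [EX EY].
set (gS := Derive_n S 2 r + sum_axis _) in EX, EY.
set (gT := Derive_n T 2 r + sum_axis _) in EX, EY.
match goal with |- _ <-> (?L = 0 /\ ?M = 0) =>
  replace L with (gS / P (S r) + gT / Q (T r)) by (rewrite <- EX; field; auto);
  replace M with (- (P (S r) * gS) + Q (T r) * gT) by (rewrite <- EY; ring)
end.
assert (G : forall k, Derive_n (gam k) 2 r +
     sum_axis (fun i => sum_axis (fun j =>
       christoffel (null_metric P Q) k i j (S r) (T r)
       * Derive (gam i) r * Derive (gam j) r))
     = match k with axS => gS | axT => gT end).
{ intros k; unfold gS, gT, sum_axis.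
  rewrite !(christoffel_null_metric P P1 Q Q1) by assumption.
  destruct k; reflexivity. }
split.
- intros H; pose proof (H axS) as HS; pose proof (H axT) as HT.
  rewrite G in HS, HT; rewrite HS, HT; split; field; auto.
- intros [HX HY] k; rewrite G.
  assert (KS : gS * (P (S r) ^ 2 + Q (T r) ^ 2) = 0).
  { transitivity (P (S r) * Q (T r) ^ 2 * (gS / P (S r) + gT / Q (T r))
      - P (S r) * (- (P (S r) * gS) + Q (T r) * gT)); [field; auto|].
    rewrite HX, HY; ring. }
  assert (KT : gT * (P (S r) ^ 2 + Q (T r) ^ 2) = 0).
  { transitivity (P (S r) ^ 2 * Q (T r) * (gS / P (S r) + gT / Q (T r))
      + Q (T r) * (- (P (S r) * gS) + Q (T r) * gT)); [field; auto|].
    rewrite HX, HY; ring. }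
  apply Rmult_integral in KS; apply Rmult_integral in KT.
  destruct k; [destruct KS|destruct KT]; tauto.
Qed.

(** A null metric whose null coordinates are onto is complete: geodesics are
    the preimages of the straight lines. *)
Lemma null_metric_complete P Q A1 A2 B1 B2 :
  smooth P -> smooth Q -> null_data P Q A1 A2 B1 B2 -> null_onto A1 A2 B1 B2 ->
  geodesically_complete (null_metric P Q).
Proof.
intros sP sQ ND onto a b gam Hab Hgam.
pose proof ND as [cP [cQ [P0 [Q0 [HA1 [HA2 [HB1 HB2]]]]]]].
assert (HP : forall s : R, is_derive P s (Derive P s))
  by (intros s; apply smooth_at_is_derive, sP).
assert (HQ : forall t : R, is_derive Q t (Derive Q t))
  by (intros t; apply smooth_at_is_derive, sQ).
assert (HP' : forall s : R, is_derive (fun x => / P x) s (- Derive P s / P s ^ 2))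
  by (intros; now apply is_derive_inv_neq).
assert (HQ' : forall s : R, is_derive (fun x => / Q x) s (- Derive Q s / Q s ^ 2))
  by (intros; now apply is_derive_inv_neq).
assert (HmA2 : forall s : R, is_derive (fun x => - A2 x) s (- P s))
  by (intros s; apply (is_derive_opp (V := R_NormedModule)), HA2).
assert (HmP : forall s : R, is_derive (fun x => - P x) s (- Derive P s))
  by (intros s; apply (is_derive_opp (V := R_NormedModule)), HP).
destruct (Rbar_interval_inhabited a b Hab) as [r0 [Ha Hb]].
set (S := gam axS); set (T := gam axT).
set (X1 := fun r => Derive S r * / P (S r) + Derive T r * / Q (T r)).
set (Y1 := fun r => Derive S r * - P (S r) + Derive T r * Q (T r)).
assert (EX := affine_of_second_derivative_zero a b (fun r => A1 (S r) + B1 (T r)) X1).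
assert (EY := affine_of_second_derivative_zero a b (fun r => - A2 (S r) + B2 (T r)) Y1).
assert (Sm : forall r : R, Rbar_lt a r -> Rbar_lt r b -> smooth_at S r /\ smooth_at T r).
{ intros r Har Hrb; destruct (Hgam r Har Hrb) as [H _]; split; apply H. }
assert (Z : forall r : R, Rbar_lt a r -> Rbar_lt r b -> is_derive X1 r 0 /\ is_derive Y1 r 0).
{ intros r Har Hrb; destruct (Sm r Har Hrb) as [SS ST].
  destruct (Hgam r Har Hrb) as [_ H].
  apply (geodesic_iff_affine P (Derive P) Q (Derive Q)) in H as [KX KY]; auto.
  split; [rewrite <- KX|rewrite <- KY].
  - now apply (derive2_sum_comp (fun x => / P x) (fun x => / Q x)
      (fun s => - Derive P s / P s ^ 2) (fun s => - Derive Q s / Q s ^ 2)).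
  - now apply (derive2_sum_comp (fun x => - P x) Q (fun s => - Derive P s) (Derive Q)). }
assert (EX' := EX
  (fun r h1 h2 => derive_sum_comp A1 B1 _ _ S T r HA1 HB1 (proj1 (Sm r h1 h2)) (proj2 (Sm r h1 h2)))
  (fun r h1 h2 => proj1 (Z r h1 h2)) r0).
assert (EY' := EY
  (fun r h1 h2 => derive_sum_comp (fun x => - A2 x) B2 _ _ S T r HmA2 HB2
     (proj1 (Sm r h1 h2)) (proj2 (Sm r h1 h2)))
  (fun r h1 h2 => proj2 (Z r h1 h2)) r0).
clear EX EY Z.
set (p := X1 r0) in *; set (q := A1 (S r0) + B1 (T r0) - p * r0) in *.
set (p' := Y1 r0) in *; set (q' := - A2 (S r0) + B2 (T r0) - p' * r0) in *.
destruct (functional_choice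
  (fun r (st : R * R) => A1 (fst st) + B1 (snd st) = p * r + q /\
     - A2 (fst st) + B2 (snd st) = p' * r + q')) as [G HG].
{ intros r; destruct (onto (p * r + q) (p' * r + q')) as [s [t H]]; now exists (s, t). }
set (GS := fun r => fst (G r)); set (GT := fun r => snd (G r)).
assert (GX : forall r, A1 (GS r) + B1 (GT r) = p * r + q) by (intros r; apply HG).
assert (GY : forall r, - A2 (GS r) + B2 (GT r) = p' * r + q') by (intros r; apply HG).
destruct (null_line_smooth _ _ _ _ _ _ _ _ _ _ _ _ ND sP sQ GX GY) as [sS sT].
exists (fun k => match k with axS => GS | axT => GT end); split.
- intros r _ _; split; [intros [|]; [apply sS|apply sT]|].
  apply (geodesic_iff_affine P (Derive P) Q (Derive Q)); auto.
  assert (DX : forall r, Derive GS r * / P (GS r) + Derive GT r * / Q (GT r) = p).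
  { intros x.
    rewrite <- (is_derive_unique _ _ _
      (derive_sum_comp A1 B1 _ _ GS GT x HA1 HB1 (sS x) (sT x))).
    apply is_derive_unique; apply (is_derive_ext (fun r => p * r + q));
      [intros; now rewrite GX|auto_derive; auto; ring]. }
  assert (DY : forall r, Derive GS r * - P (GS r) + Derive GT r * Q (GT r) = p').
  { intros x.
    rewrite <- (is_derive_unique _ _ _
      (derive_sum_comp (fun x => - A2 x) B2 _ _ GS GT x HmA2 HB2 (sS x) (sT x))).
    apply is_derive_unique; apply (is_derive_ext (fun r => p' * r + q'));
      [intros; now rewrite GY|auto_derive; auto; ring]. }
  cbn beta iota; split.
  + transitivity (Derive (fun _ => p) r); [|apply Derive_const].
    rewrite <- (Derive_ext _ _ r DX); symmetry; apply is_derive_unique.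
    exact (derive2_sum_comp (fun x => / P x) (fun x => / Q x)
        (fun s => - Derive P s / P s ^ 2) (fun s => - Derive Q s / Q s ^ 2)
        GS GT r (HP' _) (HQ' _) (sS r) (sT r)).
  + transitivity (Derive (fun _ => p') r); [|apply Derive_const].
    rewrite <- (Derive_ext _ _ r DY); symmetry; apply is_derive_unique.
    exact (derive2_sum_comp (fun x => - P x) Q (fun s => - Derive P s) (Derive Q)
        GS GT r (HmP _) (HQ _) (sS r) (sT r)).
- intros k r Har Hrb.
  destruct (null_injective _ _ _ _ _ _ ND (GS r) (GT r) (S r) (T r)) as [ES ET].
  + rewrite GX; symmetry; now apply EX'.
  + rewrite GY; symmetry; now apply EY'.
  + destruct k; assumption.
Qed.

(** * Curves and their logarithmic derivatives *)

Lemma R42_ext z w :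
  Defs.x0 z = Defs.x0 w -> x1 z = x1 w -> x2 z = x2 w -> x3 z = x3 w -> z = w.
Proof. destruct z, w; simpl; intros; subst; reflexivity. Qed.

(** The form [- qdot z z = z conj(z)] is multiplicative. *)
Lemma qdot_mul z w : qdot (qmul z w) (qmul z w) = - (qdot z z * qdot w w).
Proof. unfold qdot, qmul; simpl; ring. Qed.

Lemma qdot_conj z w : qdot (qconj z) (qconj w) = qdot z w.
Proof. unfold qdot, qconj; simpl; ring. Qed.

Definition smooth_curve (b : R -> R42) : Prop := forall s, curve_smooth_at b s.

Lemma curve_smooth_derivable b s :
  curve_smooth_at b s ->
  ex_derive (fun r : R => Defs.x0 (b r)) s /\ ex_derive (fun r : R => x1 (b r)) s /\
  ex_derive (fun r : R => x2 (b r)) s /\ ex_derive (fun r : R => x3 (b r)) s.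
Proof.
intros [H0 [H1 [H2 H3]]]; split; [|split; [|split]];
  [apply (H0 1%nat)|apply (H1 1%nat)|apply (H2 1%nat)|apply (H3 1%nat)].
Qed.

Lemma smooth_curve_components b :
  smooth_curve b -> smooth (fun r : R => Defs.x0 (b r)) /\ smooth (fun r : R => x1 (b r)) /\
  smooth (fun r : R => x2 (b r)) /\ smooth (fun r : R => x3 (b r)).
Proof. intros H; split; [|split; [|split]]; intros s; apply (H s). Qed.

Lemma Derive_combination (f f0 f1 f2 f3 : R -> R) (c0 c1 c2 c3 s : R) :
  ex_derive f0 s -> ex_derive f1 s -> ex_derive f2 s -> ex_derive f3 s ->
  (forall r, f r = c0 * f0 r + c1 * f1 r + c2 * f2 r + c3 * f3 r) ->
  Derive f s = c0 * Derive f0 s + c1 * Derive f1 s + c2 * Derive f2 s + c3 * Derive f3 s.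
Proof.
intros H0 H1 H2 H3 E; rewrite (Derive_ext _ _ s E).
apply is_derive_unique; auto_derive; [tauto|].
change (fun x => f0 x) with f0; change (fun x => f1 x) with f1.
change (fun x => f2 x) with f2; change (fun x => f3 x) with f3; ring.
Qed.

(** Differentiates a linear combination of the coordinates of [b]. *)
Ltac derive_coordinate b c0 c1 c2 c3 :=
  rewrite (Derive_combination _ (fun r : R => Defs.x0 (b r)) (fun r : R => x1 (b r))
    (fun r : R => x2 (b r)) (fun r : R => x3 (b r)) c0 c1 c2 c3);
  [ring|assumption|assumption|assumption|assumption|intros; ring].

Lemma dcurve_mul_r b w s :
  curve_smooth_at b s -> dcurve (fun r => qmul (b r) w) s = qmul (dcurve b s) w.
Proof.
intros H; apply curve_smooth_derivable in H as [H0 [H1 [H2 H3]]].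
destruct w as [w0 w1 w2 w3]; apply R42_ext; simpl.
- derive_coordinate b w0 (- w1) w2 w3.
- derive_coordinate b w1 w0 (- w3) w2.
- derive_coordinate b w2 (- w3) w0 w1.
- derive_coordinate b w3 w2 (- w1) w0.
Qed.

Lemma dcurve_mul_conj z b s :
  curve_smooth_at b s ->
  dcurve (fun r => qmul z (qconj (b r))) s = qmul z (qconj (dcurve b s)).
Proof.
intros H; apply curve_smooth_derivable in H as [H0 [H1 [H2 H3]]].
destruct z as [z0 z1 z2 z3]; apply R42_ext; simpl.
- derive_coordinate b z0 z1 (- z2) (- z3).
- derive_coordinate b z1 (- z0) (- z3) z2.
- derive_coordinate b z2 (- z3) (- z0) z1.
- derive_coordinate b z3 z2 (- z1) (- z0).
Qed.

Lemma dcurve_comp a u s :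
  ex_derive u s -> curve_smooth_at a (u s) ->
  dcurve (fun r => a (u r)) s = qscal (Derive u s) (dcurve a (u s)).
Proof.
intros Hu H; apply curve_smooth_derivable in H as [H0 [H1 [H2 H3]]].
apply R42_ext; simpl;
  [apply (Derive_comp (fun r => Defs.x0 (a r)))|apply (Derive_comp (fun r => x1 (a r)))
  |apply (Derive_comp (fun r => x2 (a r)))|apply (Derive_comp (fun r => x3 (a r)))];
  assumption.
Qed.

Lemma log_derivative_comp a u s :
  ex_derive u s -> curve_smooth_at a (u s) ->
  log_derivative (fun r => a (u r)) s = qscal (Derive u s) (log_derivative a (u s)).
Proof.
intros Hu H; unfold log_derivative; rewrite dcurve_comp by assumption.
apply R42_ext; simpl; ring.
Qed.

(** The curves of the theorem, up to the causal character of their velocity. *)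
Definition contact_curve (b : R -> R42) : Prop :=
  smooth_curve b /\ (forall s, in_H31 (b s)) /\
  (forall s, qdot (dcurve b s) (qmul (b s) qj) = 0).

(** The coefficients of [i] and [k] in the logarithmic derivative. *)
Definition lam (b : R -> R42) (s : R) : R := x1 (log_derivative b s).
Definition mu (b : R -> R42) (s : R) : R := x3 (log_derivative b s).

Lemma log_derivative_lam_mu b s :
  contact_curve b -> log_derivative b s = mkR42 0 (lam b s) 0 (mu b s).
Proof.
intros [Hs [HH Hj]]; apply R42_ext; try reflexivity; simpl.
- destruct (curve_smooth_derivable b s (Hs s)) as [H0 [H1 [H2 H3]]].
  assert (E : Derive (fun r => qdot (b r) (b r)) s = 0).
  { rewrite (Derive_ext _ (fun _ => -1)) by exact HH; apply Derive_const. }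
  assert (K : forall f0 f1 f2 f3 : R -> R,
    ex_derive f0 s -> ex_derive f1 s -> ex_derive f2 s -> ex_derive f3 s ->
    Derive (fun r => - (f0 r * f0 r) - f1 r * f1 r + f2 r * f2 r + f3 r * f3 r) s
    = - (2 * f0 s * Derive f0 s) - 2 * f1 s * Derive f1 s + 2 * f2 s * Derive f2 s
      + 2 * f3 s * Derive f3 s).
  { intros f0 f1 f2 f3 h0 h1 h2 h3.
    apply is_derive_unique; auto_derive; [tauto|].
    change (fun x => f0 x) with f0; change (fun x => f1 x) with f1.
    change (fun x => f2 x) with f2; change (fun x => f3 x) with f3; ring. }
  specialize (K _ _ _ _ H0 H1 H2 H3); unfold qdot in E; rewrite K in E; cbv beta in E.
  lra.
- specialize (Hj s); rewrite <- Hj; unfold qdot; simpl; ring.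
Qed.

Lemma qdot_velocity b s :
  contact_curve b -> qdot (dcurve b s) (dcurve b s) = mu b s ^ 2 - lam b s ^ 2.
Proof.
intros H; pose proof (log_derivative_lam_mu b s H) as E.
destruct H as [_ [HH _]]; specialize (HH s); red in HH.
transitivity (qdot (log_derivative b s) (log_derivative b s)).
- unfold log_derivative; rewrite qdot_mul, qdot_conj, HH; ring.
- rewrite E; unfold qdot; simpl; ring.
Qed.

Lemma smooth_lam_mu b : smooth_curve b -> smooth (lam b) /\ smooth (mu b).
Proof.
intros H; apply smooth_curve_components in H as [H0 [H1 [H2 H3]]].
pose proof (smooth_Derive _ H0) as D0; pose proof (smooth_Derive _ H1) as D1.
pose proof (smooth_Derive _ H2) as D2; pose proof (smooth_Derive _ H3) as D3.
rewrite smooth_Ck in H0, H1, H2, H3, D0, D1, D2, D3; rewrite !smooth_Ck.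
split; intros n; unfold lam, mu, log_derivative, qmul, qconj, dcurve; simpl;
  repeat first [apply Ck_plus | apply Ck_minus | apply Ck_mult | apply Ck_opp | auto].
Qed.

Lemma admissible_contact b1 b2 :
  admissible_pair b1 b2 ->
  contact_curve b1 /\ contact_curve b2 /\
  (forall s, lam b1 s ^ 2 - mu b1 s ^ 2 = 1) /\
  (forall t, mu b2 t ^ 2 - lam b2 t ^ 2 = 1).
Proof.
intros [R1 [R2 [_ [_ [L1 [L2 [J1 J2]]]]]]].
assert (C1 : contact_curve b1) by (split; [|split]; [intros s; apply R1|intros s; apply R1|exact J1]).
assert (C2 : contact_curve b2) by (split; [|split]; [intros s; apply R2|intros s; apply R2|exact J2]).
split; [exact C1|split; [exact C2|split]].
- intros s; specialize (L1 s); rewrite (qdot_velocity b1 s C1) in L1; lra.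
- intros t; specialize (L2 t); rewrite (qdot_velocity b2 t C2) in L2; lra.
Qed.

(** * The surface [b1 conj(b2)] *)

(** The functions [P] and [Q] of the null frame, for [b = b1] and [b = b2]. *)
Definition null_factor (b : R -> R42) (s : R) : R := lam b s + mu b s.

Lemma smooth_null_factor b : smooth_curve b -> smooth (null_factor b).
Proof.
intros H; apply smooth_lam_mu in H as [H1 H2]; rewrite smooth_Ck in H1, H2.
apply smooth_Ck; intros n; now apply Ck_plus.
Qed.

Section Surface.

Variables b1 b2 : R -> R42.
Hypothesis Hadm : admissible_pair b1 b2.

Let P := null_factor b1.
Let Q := null_factor b2.

Lemma inv_P s : P s <> 0 /\ / P s = lam b1 s - mu b1 s.
Proof.
destruct (admissible_contact b1 b2 Hadm) as [_ [_ [E _]]]; specialize (E s).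
assert (N : P s <> 0) by (unfold P, null_factor; nra).
split; [exact N|]; apply Rmult_eq_reg_l with (P s); [|exact N].
rewrite Rinv_r by exact N; unfold P, null_factor; lra.
Qed.

Lemma inv_Q t : Q t <> 0 /\ / Q t = mu b2 t - lam b2 t.
Proof.
destruct (admissible_contact b1 b2 Hadm) as [_ [_ [_ E]]]; specialize (E t).
assert (N : Q t <> 0) by (unfold Q, null_factor; nra).
split; [exact N|]; apply Rmult_eq_reg_l with (Q t); [|exact N].
rewrite Rinv_r by exact N; unfold Q, null_factor; lra.
Qed.

Lemma P_neq_0 s : P s <> 0. Proof. apply inv_P. Qed.
Lemma Q_neq_0 t : Q t <> 0. Proof. apply inv_Q. Qed.

Lemma smooth_P : smooth P.
Proof. apply smooth_null_factor, (admissible_contact b1 b2 Hadm). Qed.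

Lemma smooth_Q : smooth Q.
Proof. apply smooth_null_factor, (admissible_contact b1 b2 Hadm). Qed.

Lemma induced_metric_null : induced_metric (surface_of b1 b2) = null_metric P Q.
Proof.
destruct (admissible_contact b1 b2 Hadm) as [C1 [C2 _]].
destruct Hadm as [R1 [R2 [_ [_ [L1 [L2 _]]]]]].
apply functional_extensionality; intros i; apply functional_extensionality; intros j.
apply functional_extensionality; intros s; apply functional_extensionality; intros t.
pose proof (log_derivative_lam_mu b1 s C1) as E1.
pose proof (log_derivative_lam_mu b2 t C2) as E2.
destruct (R1 s) as [S1 [H1 _]], (R2 t) as [S2 [H2 _]]; red in H1, H2.
assert (DS : dsurface (surface_of b1 b2) axS s t = qmul (dcurve b1 s) (qconj (b2 t)))
  by (apply (dcurve_mul_r b1 (qconj (b2 t))), S1).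
assert (DT : dsurface (surface_of b1 b2) axT s t = qmul (b1 s) (qconj (dcurve b2 t)))
  by (apply (dcurve_mul_conj (b1 s) b2), S2).
specialize (L1 s); specialize (L2 t).
(* <b1' conj b2, b1 conj b2'> is minus the real part of the product of the
   logarithmic derivatives *)
assert (F : qdot (qmul (dcurve b1 s) (qconj (b2 t))) (qmul (b1 s) (qconj (dcurve b2 t)))
            = (Q t / P s - P s / Q t) / 2).
{ transitivity (- Defs.x0 (qmul (log_derivative b1 s) (log_derivative b2 t))).
  - unfold log_derivative, qdot, qmul, qconj; simpl; ring.
  - rewrite E1, E2; unfold Rdiv.
    rewrite (proj2 (inv_P s)), (proj2 (inv_Q t)); unfold P, Q, null_factor; simpl; field. }
unfold induced_metric; destruct i, j; cbn [null_metric]; rewrite ?DS, ?DT.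
- rewrite qdot_mul, qdot_conj, H2; lra.
- exact F.
- rewrite <- F; unfold qdot; ring.
- rewrite qdot_mul, qdot_conj, H1; lra.
Qed.

Lemma surface_timelike_flat : timelike_flat_surface (surface_of b1 b2).
Proof.
destruct (admissible_contact b1 b2 Hadm) as [C1 [C2 _]].
split; [|split; [split|split]].
- intros s t; unfold surface_of; red; rewrite qdot_mul, qdot_conj.
  destruct C1 as [_ [H1 _]], C2 as [_ [H2 _]].
  specialize (H1 s); specialize (H2 t); red in H1, H2; rewrite H1, H2; ring.
- destruct (smooth_curve_components b1 (proj1 C1)) as [p0 [p1 [p2 p3]]].
  destruct (smooth_curve_components b2 (proj1 C2)) as [q0 [q1 [q2 q3]]].
  assert (K : forall f0 f1 f2 f3, smooth f0 -> smooth f1 -> smooth f2 -> smooth f3 ->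
    forall f, (forall s t, f s t = f0 s * Defs.x0 (b2 t) + f1 s * x1 (b2 t)
      + f2 s * x2 (b2 t) + f3 s * x3 (b2 t)) -> smooth2 f).
  { intros f0 f1 f2 f3 h0 h1 h2 h3 f Hf.
    replace f with (fun s t => f0 s * Defs.x0 (b2 t) + f1 s * x1 (b2 t)
      + f2 s * x2 (b2 t) + f3 s * x3 (b2 t)).
    - repeat apply smooth2_plus; apply (smooth2_tensor _ (fun t => _ (b2 t))); assumption.
    - apply functional_extensionality; intros s.
      apply functional_extensionality; intros t; now rewrite Hf. }
  pose proof (smooth_opp _ p0) as m0; pose proof (smooth_opp _ p1) as m1.
  pose proof (smooth_opp _ p2) as m2; pose proof (smooth_opp _ p3) as m3.
  split; [|split; [|split]].
  + apply (K _ _ _ _ p0 p1 m2 m3); intros; simpl; ring.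
  + apply (K _ _ _ _ p1 m0 m3 p2); intros; simpl; ring.
  + apply (K _ _ _ _ p2 m3 m0 p1); intros; simpl; ring.
  + apply (K _ _ _ _ p3 p2 m1 m0); intros; simpl; ring.
- intros s t X H.
  pose proof induced_metric_null as G.
  set (v := dsurface (surface_of b1 b2) axS s t) in *.
  set (w := dsurface (surface_of b1 b2) axT s t) in *.
  assert (Gvv : qdot v v = -1)
    by exact (f_equal (fun g => g axS axS s t) G).
  assert (Gww : qdot w w = 1)
    by exact (f_equal (fun g => g axT axT s t) G).
  assert (Ev : X axS * qdot v v + X axT * qdot v w = 0).
  { transitivity (qdot (qadd (qscal (X axS) v) (qscal (X axT) w)) v);
      [unfold qdot, qadd, qscal; simpl; ring|rewrite H; unfold qdot; simpl; ring]. }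
  assert (Ew : X axS * qdot v w + X axT * qdot w w = 0).
  { transitivity (qdot (qadd (qscal (X axS) v) (qscal (X axT) w)) w);
      [unfold qdot, qadd, qscal; simpl; ring|rewrite H; unfold qdot; simpl; ring]. }
  rewrite Gvv in Ev; rewrite Gww in Ew.
  assert (T0 : X axT = 0).
  { apply Rmult_eq_reg_r with (1 + qdot v w ^ 2); [|pose proof (pow2_ge_0 (qdot v w)); lra].
    transitivity ((X axS * -1 + X axT * qdot v w) * qdot v w
      + (X axS * qdot v w + X axT * 1)); [ring|rewrite Ev, Ew; ring]. }
  intros [|]; [rewrite T0 in Ev; lra|exact T0].
- rewrite induced_metric_null; apply null_metric_lorentzian.
- rewrite induced_metric_null.
  pose proof smooth_P as SP; pose proof smooth_Q as SQ.
  pose proof (smooth_Derive _ SP) as SP1; pose proof (smooth_Derive _ SQ) as SQ1.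
  apply (null_metric_flat P (Derive P) (Derive (Derive P)) Q (Derive Q) (Derive (Derive Q)));
    [| | | |exact P_neq_0|exact Q_neq_0]; intros x; apply smooth_at_is_derive;
    [apply SP|apply SQ|apply SP1|apply SQ1].
Qed.

(** * Asymptotic parameters *)

(** The chain rule for [b = a o u], whose logarithmic derivative is [u'] times a
    vector with [lam^2 + mu^2 = 1]. *)
Lemma asymptotic_speed b u a s :
  contact_curve b -> asymptotic_parameter b u a ->
  Derive u s ^ 2 = lam b s ^ 2 + mu b s ^ 2 /\
  lam b s = Derive u s * x1 (log_derivative a (u s)) /\
  mu b s = Derive u s * x3 (log_derivative a (u s)).
Proof.
intros Hb [Hu [_ [_ [Hab Ha]]]]; destruct (Ha s) as [Sa [l [m [E N]]]].
assert (H : log_derivative b s = qscal (Derive u s) (log_derivative a (u s))).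
{ rewrite <- log_derivative_comp; [|now apply smooth_ex_derive|exact Sa].
  f_equal; apply functional_extensionality; intros r; symmetry; apply Hab. }
assert (K : lam b s = Derive u s * x1 (log_derivative a (u s)) /\
            mu b s = Derive u s * x3 (log_derivative a (u s)))
  by (unfold lam, mu; rewrite H; split; reflexivity).
split; [|exact K]; destruct K as [-> ->]; rewrite E; simpl.
replace (Derive u s * (Derive u s * 1)) with (Derive u s ^ 2 * (l ^ 2 + m ^ 2))
  by (rewrite N; ring); ring.
Qed.

Lemma smooth_inverse u :
  smooth u -> (forall s, 1 <= Derive u s ^ 2) ->
  exists g, smooth g /\ (forall s, g (u s) = s) /\ (forall x, u (g x) = x) /\
    forall x, is_derive g x (/ Derive u (g x)).
Proof.
intros Hu H1.
destruct (inverse_of_derive_bounded_below u (Derive u) 1) as [g [G1 [G2 G3]]].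
- lra.
- intros s; apply smooth_at_is_derive, Hu.
- intros s; apply smooth_continuous, smooth_Derive, Hu.
- exact H1.
- exists g; split; [|auto]; apply smooth_Ck.
  apply (inverse_smooth g (Derive u)); [apply smooth_Ck, smooth_Derive, Hu| |exact G3].
  intros x E; specialize (H1 x); rewrite E in H1; lra.
Qed.

Lemma lam_mu_ge_1 :
  (forall s, 1 <= lam b1 s ^ 2 + mu b1 s ^ 2) /\
  (forall t, 1 <= lam b2 t ^ 2 + mu b2 t ^ 2).
Proof.
destruct (admissible_contact b1 b2 Hadm) as [_ [_ [E1 E2]]]; split.
- intros s; specialize (E1 s); pose proof (pow2_ge_0 (mu b1 s)); lra.
- intros t; specialize (E2 t); pose proof (pow2_ge_0 (lam b2 t)); lra.
Qed.

Lemma asymptotic_parameters_diffeomorphism u v a1 a2 :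
  asymptotic_parameters b1 b2 u v a1 a2 ->
  diffeomorphism (fun p : R * R => (u (fst p), v (snd p))).
Proof.
intros [H1 [_ H2]].
destruct (admissible_contact b1 b2 Hadm) as [C1 [C2 _]].
destruct lam_mu_ge_1 as [M1 M2].
destruct (smooth_inverse u) as [g [Sg [G1 [G2 _]]]]; [apply H1| |].
{ intros s; destruct (asymptotic_speed b1 u a1 s C1 H1) as [-> _]; apply M1. }
destruct (smooth_inverse v) as [h [Sh [K1 [K2 _]]]]; [apply H2| |].
{ intros s; destruct (asymptotic_speed b2 v a2 s C2 H2) as [-> _]; apply M2. }
split; [split|].
- simpl; apply smooth2_fst, H1.
- simpl; apply smooth2_snd, H2.
- exists (fun p => (g (fst p), h (snd p))); split; [split|split].
  + simpl; apply smooth2_fst, Sg.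
  + simpl; apply smooth2_snd, Sh.
  + intros [s t]; simpl; now rewrite G1, K1.
  + intros [x y]; simpl; now rewrite G2, K2.
Qed.

(** Here [lam1 mu2 - mu1 lam2 = u' v' sin omega], and this determinant equals
    [(P/Q + Q/P) / 2]. *)
Lemma complete_of_angle_bound u v a1 a2 w1 w2 c :
  asymptotic_parameters b1 b2 u v a1 a2 -> normalized_angles a1 a2 w1 w2 ->
  0 < c -> (forall x y, c <= sin (w1 x + w2 y)) ->
  geodesically_complete (induced_metric (surface_of b1 b2)).
Proof.
intros [H1 [_ H2]] [[_ W1] [[w [[_ W2] Ew]] _]] Hc Hs.
destruct (admissible_contact b1 b2 Hadm) as [C1 [C2 _]].
rewrite induced_metric_null.
destruct (null_data_exists P Q) as [A1 [A2 [B1 [B2 ND]]]].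
{ intros; apply smooth_continuous, smooth_P. }
{ intros; apply smooth_continuous, smooth_Q. }
{ apply P_neq_0. }
{ apply Q_neq_0. }
apply (null_metric_complete P Q A1 A2 B1 B2 smooth_P smooth_Q ND).
apply (null_onto_of_angle_bound P Q A1 A2 B1 B2 c ND Hc).
intros s t; specialize (Hs (u s) (v t)).
destruct (asymptotic_speed b1 u a1 s C1 H1) as [N1 [l1 m1]].
destruct (asymptotic_speed b2 v a2 t C2 H2) as [N2 [l2 m2]].
rewrite (W1 (u s)) in l1, m1; rewrite (W2 (v t)) in l2, m2; simpl in l1, m1, l2, m2.
assert (ES : Derive u s * Derive v t * sin (w1 (u s) + w2 (v t))
             = lam b1 s * mu b2 t - mu b1 s * lam b2 t).
{ rewrite l1, m1, l2, m2, Ew.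
  replace (w1 (u s) + (PI - w (v t))) with (PI - (w (v t) - w1 (u s))) by ring.
  rewrite sin_PI_x, sin_minus; ring. }
set (D := lam b1 s * mu b2 t - mu b1 s * lam b2 t) in *.
assert (HD : c ^ 2 * ((lam b1 s ^ 2 + mu b1 s ^ 2) * (lam b2 t ^ 2 + mu b2 t ^ 2)) <= D ^ 2).
{ rewrite <- N1, <- N2, <- ES.
  replace ((Derive u s * Derive v t * sin (w1 (u s) + w2 (v t))) ^ 2)
    with (sin (w1 (u s) + w2 (v t)) ^ 2 * (Derive u s ^ 2 * Derive v t ^ 2)) by ring.
  apply Rmult_le_compat_r; [apply Rmult_le_pos; apply pow2_ge_0|].
  apply pow_incr; lra. }
destruct (inv_P s) as [P0 IP], (inv_Q t) as [Q0 IQ].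
assert (eP : (P s ^ 2) ^ 2 + 1 = P s ^ 2 * (2 * (lam b1 s ^ 2 + mu b1 s ^ 2))).
{ replace (2 * (lam b1 s ^ 2 + mu b1 s ^ 2)) with (P s ^ 2 + (/ P s) ^ 2)
    by (rewrite IP; unfold P, null_factor; ring); field; exact P0. }
assert (eQ : (Q t ^ 2) ^ 2 + 1 = Q t ^ 2 * (2 * (lam b2 t ^ 2 + mu b2 t ^ 2))).
{ replace (2 * (lam b2 t ^ 2 + mu b2 t ^ 2)) with (Q t ^ 2 + (/ Q t) ^ 2)
    by (rewrite IQ; unfold Q, null_factor; ring); field; exact Q0. }
assert (ePQ : P s ^ 2 + Q t ^ 2 = P s * Q t * (2 * D)).
{ replace (2 * D) with (P s * / Q t + Q t * / P s)
    by (rewrite IP, IQ; unfold D, P, Q, null_factor; ring); field; auto. }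
rewrite eP, eQ, ePQ.
replace (c ^ 2 * (P s ^ 2 * (2 * (lam b1 s ^ 2 + mu b1 s ^ 2)))
         * (Q t ^ 2 * (2 * (lam b2 t ^ 2 + mu b2 t ^ 2))))
  with (4 * (P s * Q t) ^ 2 *
    (c ^ 2 * ((lam b1 s ^ 2 + mu b1 s ^ 2) * (lam b2 t ^ 2 + mu b2 t ^ 2)))) by ring.
replace ((P s * Q t * (2 * D)) ^ 2) with (4 * (P s * Q t) ^ 2 * D ^ 2) by ring.
apply Rmult_le_compat_l; [pose proof (pow2_ge_0 (P s * Q t)); lra|exact HD].
Qed.

End Surface.

(** ** Existence of normalized asymptotic parameters *)

Lemma smooth_curve_comp b g :
  smooth_curve b -> smooth g -> smooth_curve (fun x => b (g x)).
Proof.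
intros Hb Hg; apply smooth_curve_components in Hb as [H0 [H1 [H2 H3]]].
rewrite smooth_Ck in H0, H1, H2, H3, Hg.
assert (K : forall f, (forall n, Ck n allR f) -> smooth (fun x => f (g x))).
{ intros f Hf; apply smooth_Ck; intros n.
  apply (Ck_comp n allR allR f g); unfold allR; auto. }
intros s; split; [|split; [|split]];
  [apply (K _ H0)|apply (K _ H1)|apply (K _ H2)|apply (K _ H3)].
Qed.

(** The speed [|u'|] of an asymptotic parameter [u] of [b]. *)
Definition asymptotic_norm (b : R -> R42) (s : R) : R := sqrt (lam b s ^ 2 + mu b s ^ 2).

(** The sign [eps] is the orientation of the parameter. *)
Lemma asymptotic_reparametrization b eps :
  contact_curve b -> (forall s, 1 <= lam b s ^ 2 + mu b s ^ 2) -> eps ^ 2 = 1 ->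
  exists u g, smooth g /\ (forall s, Derive u s = eps * asymptotic_norm b s) /\
    asymptotic_parameter b u (fun x => b (g x)) /\
    forall x, log_derivative (fun y => b (g y)) x
      = mkR42 0 (eps * lam b (g x) / asymptotic_norm b (g x))
              0 (eps * mu b (g x) / asymptotic_norm b (g x)).
Proof.
intros Cb H1 He; pose proof Cb as [Sb _].
pose proof (smooth_lam_mu b Sb) as [Sl Sm]; rewrite smooth_Ck in Sl, Sm.
assert (N2 : forall s, asymptotic_norm b s ^ 2 = lam b s ^ 2 + mu b s ^ 2).
{ intros s; unfold asymptotic_norm; apply pow2_sqrt; specialize (H1 s); lra. }
assert (N0 : forall s, 0 < asymptotic_norm b s).
{ intros s; apply sqrt_lt_R0; specialize (H1 s); lra. }
assert (SN : forall n, Ck n allR (fun s => eps * asymptotic_norm b s)).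
{ intros n; apply Ck_mult; [apply Ck_const|].
  apply (Ck_comp n allR (fun x => 0 < x) sqrt); [|apply Ck_sqrt|].
  - intros s _; specialize (H1 s); lra.
  - simpl; apply Ck_plus;
      (apply Ck_mult; [auto|apply Ck_mult; [auto|apply Ck_const]]). }
assert (He0 : eps <> 0) by (intros E; rewrite E in He; lra).
assert (N0' : forall s, eps * asymptotic_norm b s <> 0).
{ intros s; apply Rmult_integral_contrapositive; split; [exact He0|].
  specialize (N0 s); lra. }
destruct (antiderivative (fun s => eps * asymptotic_norm b s)) as [u [u0 Hu]].
{ intros s; apply smooth_continuous, smooth_Ck, SN. }
assert (Du : forall s, Derive u s = eps * asymptotic_norm b s)
  by (intros s; apply is_derive_unique, Hu).
assert (Su : smooth u).
{ apply smooth_Ck; intros [|n]; [exact I|].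
  exists (fun s => eps * asymptotic_norm b s); split; [intros s _; apply Hu|apply SN]. }
destruct (smooth_inverse u Su) as [g [Sg [gu [ug Hg]]]].
{ intros s; rewrite Du; replace ((eps * asymptotic_norm b s) ^ 2)
    with (eps ^ 2 * asymptotic_norm b s ^ 2) by ring; rewrite He, N2; specialize (H1 s); lra. }
assert (L : forall x, log_derivative (fun y => b (g y)) x
      = mkR42 0 (eps * lam b (g x) / asymptotic_norm b (g x))
              0 (eps * mu b (g x) / asymptotic_norm b (g x))).
{ intros x; rewrite log_derivative_comp; [|now apply smooth_ex_derive|apply Sb].
  rewrite (is_derive_unique _ _ _ (Hg x)), Du, (log_derivative_lam_mu b (g x) Cb).
  assert (E : / (eps * asymptotic_norm b (g x)) = eps / asymptotic_norm b (g x)).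
  { apply Rmult_eq_reg_l with (eps * asymptotic_norm b (g x)); [|apply N0'].
    rewrite Rinv_r by apply N0'.
    transitivity (eps ^ 2); [now rewrite He|field; apply Rgt_not_eq, N0]. }
  rewrite E; specialize (N0 (g x)); apply R42_ext; simpl; field; lra. }
exists u, g; split; [exact Sg|split; [exact Du|split; [|exact L]]].
split; [exact Su|split; [exact u0|split; [|split]]].
- intros s; rewrite Du; apply N0'.
- intros s; now rewrite gu.
- intros s; split; [now apply smooth_curve_comp|].
  exists (eps * lam b (g (u s)) / asymptotic_norm b (g (u s))),
    (eps * mu b (g (u s)) / asymptotic_norm b (g (u s))).
  split.
  + rewrite L; apply R42_ext; simpl; ring.
  + rewrite gu; specialize (N0 s).
    transitivity (eps ^ 2 * (lam b s ^ 2 + mu b s ^ 2) / asymptotic_norm b s ^ 2).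
    * field; lra.
    * rewrite He, <- N2; field; lra.
Qed.

(** Adding [0] or [PI] to an angle changes both coordinates by the same sign. *)
Lemma sign_shift eps :
  eps ^ 2 = 1 -> exists th,
  (forall x, cos (x + th) = eps * cos x) /\ (forall x, sin (x + th) = eps * sin x).
Proof.
intros He; assert (E : eps = 1 \/ eps = -1).
{ assert (H : (eps - 1) * (eps + 1) = 0) by lra.
  apply Rmult_integral in H; destruct H; [left|right]; lra. }
destruct E as [-> | ->].
- exists 0; split; intros x; rewrite Rplus_0_r; ring.
- exists PI; split; intros x; [rewrite neg_cos|rewrite neg_sin]; ring.
Qed.

Lemma atan_ratio x y eps :
  0 < eps * x -> eps ^ 2 = 1 ->
  cos (atan (y / x)) = eps * x / sqrt (x ^ 2 + y ^ 2) /\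
  sin (atan (y / x)) = eps * y / sqrt (x ^ 2 + y ^ 2).
Proof.
intros Hx He.
assert (x0 : x <> 0) by (intros E; rewrite E in Hx; lra).
assert (x2 : 0 < x * x) by now apply Rsqr_pos_lt.
assert (N0 : 0 < sqrt (x ^ 2 + y ^ 2)).
{ apply sqrt_lt_R0; pose proof (pow2_ge_0 y); simpl in *; lra. }
assert (E : sqrt (1 + (y / x) ^ 2) = sqrt (x ^ 2 + y ^ 2) / (eps * x)).
{ apply sqrt_lem_1.
  - pose proof (pow2_ge_0 (y / x)); lra.
  - apply Rlt_le, Rdiv_lt_0_compat; assumption.
  - assert (S : sqrt (x ^ 2 + y ^ 2) * sqrt (x ^ 2 + y ^ 2) = x ^ 2 + y ^ 2)
      by (apply sqrt_sqrt; pose proof (pow2_ge_0 y); simpl in *; lra).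
    transitivity (sqrt (x ^ 2 + y ^ 2) * sqrt (x ^ 2 + y ^ 2) / (eps ^ 2 * x ^ 2));
      [field; split; [exact x0|intros Z; rewrite Z in Hx; lra]|].
    rewrite S, He; field; exact x0. }
assert (e0 : eps <> 0) by (intros Z; rewrite Z in Hx; lra).
split.
- rewrite cos_atan; rewrite <- Rsqr_pow2 in E; unfold Rsqr in E |- *; rewrite E.
  field; repeat split; first [assumption|lra].
- rewrite sin_atan; rewrite <- Rsqr_pow2 in E; unfold Rsqr in E |- *; rewrite E.
  field; repeat split; first [assumption|lra].
Qed.

Lemma atan_small x y : y ^ 2 < x ^ 2 -> - (PI / 4) < atan (y / x) < PI / 4.
Proof.
intros H.
assert (x2 : 0 < x ^ 2) by (pose proof (pow2_ge_0 y); lra).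
assert (x0 : x <> 0) by (intros E; rewrite E in x2; lra).
assert (E : (y / x) ^ 2 < 1).
{ replace ((y / x) ^ 2) with (y ^ 2 / x ^ 2) by (field; exact x0).
  apply Rmult_lt_reg_r with (x ^ 2); [exact x2|].
  replace (y ^ 2 / x ^ 2 * x ^ 2) with (y ^ 2) by (field; exact x0); lra. }
rewrite <- atan_1, <- atan_opp; split; apply atan_increasing; nra.
Qed.

Lemma smooth_atan_ratio f h g :
  smooth f -> smooth h -> smooth g -> (forall x, h x <> 0) ->
  forall c d, smooth (fun x => c * atan (f (g x) / h (g x)) + d).
Proof.
rewrite !smooth_Ck; intros Hf Hh Hg H0 c d; apply smooth_Ck; intros n.
apply Ck_plus; [|apply Ck_const]; apply Ck_mult; [apply Ck_const|].
apply (Ck_comp n allR allR atan); [unfold allR; auto|apply Ck_atan|].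
apply Ck_div; [intros; apply H0|apply (Ck_comp n allR allR f)|apply (Ck_comp n allR allR h)];
  unfold allR; auto.
Qed.

Lemma constant_sign (f : R -> R) :
  smooth f -> (forall x, f x <> 0) -> exists eps, eps ^ 2 = 1 /\ forall x, 0 < eps * f x.
Proof.
intros Sf H0; destruct (nonvanishing_sign f) as [S|S]; auto.
- intros; now apply smooth_continuous.
- exists 1; split; [ring|intros x; specialize (S x); lra].
- exists (-1); split; [ring|intros x; specialize (S x); lra].
Qed.

(** Both angles are given by arctangents of absolute value less than [PI/4], up
    to the constant signs of [lam b1] and [mu b2]; the orientation of the second
    parameter is chosen so that the two signs cancel. *)
Lemma normalized_asymptotic_parameters_exist b1 b2 :
  admissible_pair b1 b2 ->
  exists (u v : R -> R) (a1 a2 : R -> R42) (w1 w2 : R -> R),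
    asymptotic_parameters b1 b2 u v a1 a2 /\ normalized_angles a1 a2 w1 w2.
Proof.
intros Hadm; destruct (admissible_contact b1 b2 Hadm) as [C1 [C2 [E1 E2]]].
destruct (lam_mu_ge_1 b1 b2 Hadm) as [M1 M2].
destruct (smooth_lam_mu b1 (proj1 C1)) as [Sl1 Sm1].
destruct (smooth_lam_mu b2 (proj1 C2)) as [Sl2 Sm2].
assert (l0 : forall s, lam b1 s <> 0).
{ intros s E; specialize (E1 s); rewrite E in E1; pose proof (pow2_ge_0 (mu b1 s)); lra. }
assert (m0 : forall t, mu b2 t <> 0).
{ intros t E; specialize (E2 t); rewrite E in E2; pose proof (pow2_ge_0 (lam b2 t)); lra. }
destruct (constant_sign _ Sl1 l0) as [e1 [e1s P1]].
destruct (constant_sign _ Sm2 m0) as [e2 [e2s P2]].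
destruct (asymptotic_reparametrization b1 1 C1 M1) as [u [g [Sg [Du [Hu Lu]]]]]; [ring|].
destruct (asymptotic_reparametrization b2 (e1 * e2) C2 M2) as [v [h [Sh [Dv [Hv Lv]]]]].
{ replace ((e1 * e2) ^ 2) with (e1 ^ 2 * e2 ^ 2) by ring; rewrite e1s, e2s; ring. }
destruct (sign_shift e1 e1s) as [th [Tc Ts]].
set (w1 := fun x => 1 * atan (mu b1 (g x) / lam b1 (g x)) + th).
set (w := fun y => -1 * atan (lam b2 (h y) / mu b2 (h y)) + (PI / 2 + th)).
exists u, v, (fun x => b1 (g x)), (fun y => b2 (h y)), w1, (fun y => PI - w y).
split; [split; [exact Hu|split; [|exact Hv]]|split; [split|split]].
- intros s; rewrite Du, Rmult_1_l; apply sqrt_lt_R0; specialize (M1 s); lra.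
- now apply smooth_atan_ratio.
- intros x; rewrite Lu; unfold w1; rewrite (Rmult_1_l (atan _)), Tc, Ts.
  destruct (atan_ratio _ (mu b1 (g x)) e1 (P1 (g x)) e1s) as [-> ->].
  unfold asymptotic_norm; set (N := sqrt _).
  apply R42_ext; simpl; try ring; unfold Rdiv.
  + transitivity (e1 ^ 2 * lam b1 (g x) * / N); [rewrite e1s|]; ring.
  + transitivity (e1 ^ 2 * mu b1 (g x) * / N); [rewrite e1s|]; ring.
- exists w; split; [split|reflexivity].
  + now apply smooth_atan_ratio.
  + intros y; rewrite Lv; unfold w; rewrite <- Rplus_assoc, Tc, Ts.
    set (r := lam b2 (h y) / mu b2 (h y)).
    replace (-1 * atan r + PI / 2) with (PI / 2 - atan r) by ring.
    rewrite cos_shift, sin_shift; unfold r.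
    destruct (atan_ratio _ (lam b2 (h y)) e2 (P2 (h y)) e2s) as [-> ->].
    unfold asymptotic_norm; rewrite (Rplus_comm (mu b2 (h y) ^ 2)).
    set (N := sqrt _); apply R42_ext; simpl; unfold Rdiv; ring.
- intros x y; unfold w1, w.
  destruct (atan_small (lam b1 (g x)) (mu b1 (g x))); [specialize (E1 (g x)); lra|].
  destruct (atan_small (mu b2 (h y)) (lam b2 (h y))); [specialize (E2 (h y)); lra|].
  pose proof PI_RGT_0; split; lra.
Qed.

(** * An incomplete surface *)

(** The curve [exp (s (i - j)) exp (s j)], where [(i - j)^2 = 0]; its logarithmic
    derivative is [cosh (2 s) i + sinh (2 s) k]. *)
Definition ex_b1 (s : R) : R42 :=
  mkR42 (cosh s - s * sinh s) (s * cosh s) (sinh s - s * cosh s) (s * sinh s).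

(** As [(k - j)^2 = 2], one has [exp (t (k - j)) = ex_C t + ex_S t (k - j)]. *)
Definition ex_C (t : R) : R := cosh (sqrt 2 * t).
Definition ex_S (t : R) : R := sinh (sqrt 2 * t) / sqrt 2.

(** The curve [exp (t (k - j)) exp (t j)]; its logarithmic derivative is
    [sinh (2 t) i + cosh (2 t) k]. *)
Definition ex_b2 (t : R) : R42 :=
  mkR42 (ex_C t * cosh t - ex_S t * sinh t) (ex_S t * sinh t)
        (ex_C t * sinh t - ex_S t * cosh t) (ex_S t * cosh t).

Lemma is_derive_cosh x : is_derive cosh x (sinh x).
Proof. apply is_derive_Reals, derivable_pt_lim_cosh. Qed.

Lemma is_derive_sinh x : is_derive sinh x (cosh x).
Proof. apply is_derive_Reals, derivable_pt_lim_sinh. Qed.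

Lemma sqrt2_sqr : sqrt 2 * sqrt 2 = 2.
Proof. apply sqrt_sqrt; lra. Qed.

Lemma is_derive_ex_C t : is_derive ex_C t (2 * ex_S t).
Proof.
unfold ex_S; pose proof sqrt2_sqr as E; pose proof (sqrt_lt_R0 2 ltac:(lra)).
replace (2 * (sinh (sqrt 2 * t) / sqrt 2)) with (sqrt 2 * sinh (sqrt 2 * t))
  by (set (r := sqrt 2) in *; rewrite <- E; field; lra).
apply (is_derive_comp cosh (fun t => sqrt 2 * t)); [apply is_derive_cosh|].
auto_derive; [auto|ring].
Qed.

Lemma is_derive_ex_S t : is_derive ex_S t (ex_C t).
Proof.
pose proof (sqrt_lt_R0 2 ltac:(lra)); unfold ex_S, ex_C, Rdiv.
replace (cosh (sqrt 2 * t)) with (sqrt 2 * cosh (sqrt 2 * t) * / sqrt 2) by (field; lra).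
apply (is_derive_scal_l (V := R_NormedModule) (fun t => sinh (sqrt 2 * t))).
apply (is_derive_comp sinh (fun t => sqrt 2 * t)); [apply is_derive_sinh|].
auto_derive; [auto|ring].
Qed.

Lemma cosh_sinh_sqr x : cosh x * cosh x - sinh x * sinh x = 1.
Proof.
unfold cosh, sinh.
replace 1 with (exp x * exp (- x)) by (rewrite <- exp_plus, Rplus_opp_r; apply exp_0).
field.
Qed.

Lemma exp_double_cosh_sinh x : exp (2 * x) = (cosh x + sinh x) * (cosh x + sinh x).
Proof.
replace (2 * x) with (x + x) by ring; rewrite exp_plus; unfold cosh, sinh; field.
Qed.

Lemma ex_C_S_sqr t : ex_C t * ex_C t - 2 * (ex_S t * ex_S t) = 1.
Proof.
rewrite <- (cosh_sinh_sqr (sqrt 2 * t)); unfold ex_C, ex_S.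
pose proof sqrt2_sqr as E; pose proof (sqrt_lt_R0 2 ltac:(lra)).
set (r := sqrt 2) in *; rewrite <- E; field; lra.
Qed.

Lemma Ck_cosh n D : Ck n D cosh.
Proof.
apply Ck_mult; [|apply Ck_const]; apply Ck_plus; [apply Ck_exp|].
apply (Ck_comp n D allR exp Ropp); [unfold allR; auto|apply Ck_exp|].
apply Ck_opp, Ck_id.
Qed.

Lemma Ck_sinh n D : Ck n D sinh.
Proof.
apply Ck_mult; [|apply Ck_const]; apply Ck_minus; [apply Ck_exp|].
apply (Ck_comp n D allR exp Ropp); [unfold allR; auto|apply Ck_exp|].
apply Ck_opp, Ck_id.
Qed.

Lemma Ck_ex_C n : Ck n allR ex_C.
Proof.
apply (Ck_comp n allR allR cosh (fun t => sqrt 2 * t)); [unfold allR; auto|apply Ck_cosh|].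
apply Ck_mult; [apply Ck_const|apply Ck_id].
Qed.

Lemma Ck_ex_S n : Ck n allR ex_S.
Proof.
apply Ck_mult; [|apply Ck_const].
apply (Ck_comp n allR allR sinh (fun t => sqrt 2 * t)); [unfold allR; auto|apply Ck_sinh|].
apply Ck_mult; [apply Ck_const|apply Ck_id].
Qed.

Lemma smooth_ex_b1 : smooth_curve ex_b1.
Proof.
intros s; split; [|split; [|split]]; simpl; revert s; apply smooth_Ck; intros n;
  repeat first [apply Ck_cosh | apply Ck_sinh | apply Ck_id
               | apply Ck_minus | apply Ck_plus | apply Ck_mult].
Qed.

Lemma smooth_ex_b2 : smooth_curve ex_b2.
Proof.
intros s; split; [|split; [|split]]; simpl; revert s; apply smooth_Ck; intros n;
  repeat first [apply Ck_cosh | apply Ck_sinh | apply Ck_ex_C | apply Ck_ex_S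
               | apply Ck_minus | apply Ck_plus | apply Ck_mult].
Qed.

Lemma dcurve_ex_b1 s :
  dcurve ex_b1 s = mkR42 (- (s * cosh s)) (cosh s + s * sinh s)
                         (- (s * sinh s)) (sinh s + s * cosh s).
Proof.
assert (xc : ex_derive cosh s) by (eexists; apply is_derive_cosh).
assert (xs : ex_derive sinh s) by (eexists; apply is_derive_sinh).
assert (dc : Derive (fun x => cosh x) s = sinh s) by apply is_derive_unique, is_derive_cosh.
assert (ds : Derive (fun x => sinh x) s = cosh s) by apply is_derive_unique, is_derive_sinh.
apply R42_ext; simpl; apply is_derive_unique; auto_derive; try tauto;
  rewrite ?dc, ?ds; ring.
Qed.

Lemma dcurve_ex_b2 t :
  dcurve ex_b2 t = mkR42 (ex_S t * cosh t) (ex_C t * sinh t + ex_S t * cosh t)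
                         (ex_S t * sinh t) (ex_C t * cosh t + ex_S t * sinh t).
Proof.
assert (xc : ex_derive cosh t) by (eexists; apply is_derive_cosh).
assert (xs : ex_derive sinh t) by (eexists; apply is_derive_sinh).
assert (xC : ex_derive ex_C t) by (eexists; apply is_derive_ex_C).
assert (xS : ex_derive ex_S t) by (eexists; apply is_derive_ex_S).
assert (dc : Derive (fun x => cosh x) t = sinh t) by apply is_derive_unique, is_derive_cosh.
assert (ds : Derive (fun x => sinh x) t = cosh t) by apply is_derive_unique, is_derive_sinh.
assert (dC : Derive (fun x => ex_C x) t = 2 * ex_S t)
  by apply is_derive_unique, is_derive_ex_C.
assert (dS : Derive (fun x => ex_S x) t = ex_C t) by apply is_derive_unique, is_derive_ex_S.
apply R42_ext; simpl; apply is_derive_unique; auto_derive; try tauto;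
  rewrite ?dc, ?ds, ?dC, ?dS; ring.
Qed.

Lemma ex_admissible : admissible_pair ex_b1 ex_b2.
Proof.
assert (H1 : forall s, in_H31 (ex_b1 s)).
{ intros s; pose proof (cosh_sinh_sqr s); unfold in_H31, qdot; simpl; nsatz. }
assert (H2 : forall t, in_H31 (ex_b2 t)).
{ intros t; pose proof (cosh_sinh_sqr t); pose proof (ex_C_S_sqr t).
  unfold in_H31, qdot; simpl; nsatz. }
assert (L1 : forall s, - qdot (dcurve ex_b1 s) (dcurve ex_b1 s) = 1).
{ intros s; pose proof (cosh_sinh_sqr s); rewrite dcurve_ex_b1; unfold qdot; simpl; nsatz. }
assert (L2 : forall t, qdot (dcurve ex_b2 t) (dcurve ex_b2 t) = 1).
{ intros t; pose proof (cosh_sinh_sqr t); pose proof (ex_C_S_sqr t).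
  rewrite dcurve_ex_b2; unfold qdot; simpl; nsatz. }
split; [|split; [|split; [|split; [|split; [exact L1|split; [exact L2|split]]]]]].
- intros s; split; [apply smooth_ex_b1|split; [apply H1|]].
  intros E; specialize (L1 s); rewrite E in L1; unfold qdot in L1; simpl in L1; lra.
- intros t; split; [apply smooth_ex_b2|split; [apply H2|]].
  intros E; specialize (L2 t); rewrite E in L2; unfold qdot in L2; simpl in L2; lra.
- unfold ex_b1; apply R42_ext; simpl; rewrite ?cosh_0, ?sinh_0; ring.
- unfold ex_b2, ex_C, ex_S; apply R42_ext; simpl;
    rewrite Rmult_0_r, ?cosh_0, ?sinh_0; unfold Rdiv; ring.
- intros s; rewrite dcurve_ex_b1; unfold qdot; simpl; ring.
- intros t; pose proof (cosh_sinh_sqr t); rewrite dcurve_ex_b2; unfold qdot; simpl; ring.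
Qed.

Lemma ex_null_factor :
  null_factor ex_b1 = (fun s => exp (2 * s)) /\ null_factor ex_b2 = (fun t => exp (2 * t)).
Proof.
split; apply functional_extensionality; intros s; rewrite exp_double_cosh_sinh;
  unfold null_factor, lam, mu, log_derivative;
  rewrite ?dcurve_ex_b1, ?dcurve_ex_b2; simpl.
- pose proof (cosh_sinh_sqr s); nsatz.
- pose proof (cosh_sinh_sqr s); pose proof (ex_C_S_sqr s); nsatz.
Qed.

(** On [r < 0], the solution [s = t] of [X = r], [Y = 0], for the null coordinates
    [X = - (exp (- 2 s) + exp (- 2 t)) / 2] and [Y = (exp (2 t) - exp (2 s)) / 2];
    it goes to infinity as [r] tends to [0]. *)
Definition ex_geodesic (k : axis) (r : R) : R := - / 2 * ln (- r).

Lemma open_negative : open (fun r => r < 0).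
Proof. apply open_lt. Qed.

Lemma ex_geodesic_smooth k r : r < 0 -> smooth_at (ex_geodesic k) r.
Proof.
intros Hr; apply (Ck_smooth_at (fun r => r < 0)); [exact open_negative| |exact Hr].
intros n; apply Ck_mult; [apply Ck_const|].
apply (Ck_comp n _ (fun x => 0 < x) ln Ropp); [intros; lra|apply Ck_ln|].
apply Ck_opp, Ck_id.
Qed.

Lemma Derive_ex_geodesic k r : r < 0 -> Derive (ex_geodesic k) r = - / (2 * r).
Proof.
intros Hr; apply is_derive_unique; unfold ex_geodesic.
auto_derive; [lra|field; lra].
Qed.

Lemma Derive2_ex_geodesic k r : r < 0 -> Derive_n (ex_geodesic k) 2 r = / (2 * r ^ 2).
Proof.
intros Hr; transitivity (Derive (fun r => - / (2 * r)) r).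
- apply Derive_ext_loc, filter_imp with (2 := open_negative r Hr).
  intros y Hy; now apply Derive_ex_geodesic.
- apply is_derive_unique; auto_derive; [lra|field; lra].
Qed.

Lemma ex_geodesic_on :
  geodesic_on (null_metric (fun s => exp (2 * s)) (fun t => exp (2 * t)))
    m_infty 0 ex_geodesic.
Proof.
intros r _ Hr; simpl in Hr; split; [intros k; now apply ex_geodesic_smooth|].
assert (D : forall s : R, is_derive (fun s => exp (2 * s)) s (2 * exp (2 * s)))
  by (intros s; auto_derive; [auto|ring]).
assert (N : forall s, exp (2 * s) <> 0) by (intros s; apply Rgt_not_eq, exp_pos).
apply (geodesic_iff_affine (fun s => exp (2 * s)) (fun s => 2 * exp (2 * s))
  (fun s => exp (2 * s)) (fun s => 2 * exp (2 * s))); auto.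
rewrite !Derive2_ex_geodesic, !Derive_ex_geodesic by exact Hr.
change (ex_geodesic axT r) with (ex_geodesic axS r).
specialize (N (ex_geodesic axS r)); set (x := exp (2 * ex_geodesic axS r)) in *.
split; field; [split; [exact N|]|]; lra.
Qed.

Lemma ex_incomplete :
  ~ geodesically_complete (null_metric (fun s => exp (2 * s)) (fun t => exp (2 * t))).
Proof.
intros H; destruct (H m_infty 0 ex_geodesic I ex_geodesic_on) as [Gam [G1 G2]].
destruct (G1 0 I I) as [Sm _]; specialize (Sm axS).
pose proof (is_derive_cont _ _ _ (smooth_at_is_derive _ _ Sm)) as C.
apply continuity_pt_filterlim in C; destruct (C 1 Rlt_0_1) as [d [d0 Hd]].
set (g0 := Gam axS 0) in *.
set (y := Rmin (d / 2) (exp (- (2 * (Rabs g0 + 1))))).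
assert (y0 : 0 < y) by (apply Rmin_glb_lt; [lra|apply exp_pos]).
assert (yd : y <= d / 2) by apply Rmin_l.
assert (L : ln y <= - (2 * (Rabs g0 + 1))).
{ rewrite <- (ln_exp (- (2 * (Rabs g0 + 1)))); apply ln_le; [exact y0|apply Rmin_r]. }
(* continuity at 0 of an extension contradicts the divergence of - ln y / 2 *)
assert (K : Rabs (Gam axS (- y) - g0) < 1).
{ apply Hd; split; [split; [exact I|lra]|].
  simpl; unfold Rdist; rewrite Rminus_0_r, Rabs_Ropp, Rabs_pos_eq; lra. }
rewrite G2 in K; [|exact I|simpl; lra].
unfold ex_geodesic in K; rewrite Ropp_involutive in K.
apply Rabs_def2 in K; pose proof (Rle_abs g0); lra.
Qed.

Theorem theorem27 :
  (forall b1 b2 : R -> R42, admissible_pair b1 b2 ->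
     timelike_flat_surface (surface_of b1 b2) /\
     (exists (u v : R -> R) (a1 a2 : R -> R42) (w1 w2 : R -> R),
        asymptotic_parameters b1 b2 u v a1 a2 /\
        normalized_angles a1 a2 w1 w2) /\
     (forall (u v : R -> R) (a1 a2 : R -> R42),
        asymptotic_parameters b1 b2 u v a1 a2 ->
        diffeomorphism (fun p : R * R => (u (fst p), v (snd p)))) /\
     (forall (u v : R -> R) (a1 a2 : R -> R42) (w1 w2 : R -> R),
        asymptotic_parameters b1 b2 u v a1 a2 ->
        normalized_angles a1 a2 w1 w2 ->
        (exists c : R, 0 < c /\ forall x y : R, c <= sin (w1 x + w2 y)) ->
        geodesically_complete (induced_metric (surface_of b1 b2)))) /\
  (exists b1 b2 : R -> R42,
     admissible_pair b1 b2 /\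
     ~ geodesically_complete (induced_metric (surface_of b1 b2))).
Proof.
split.
- intros b1 b2 H; split; [|split; [|split]].
  + now apply surface_timelike_flat.
  + now apply normalized_asymptotic_parameters_exist.
  + now apply asymptotic_parameters_diffeomorphism.
  + intros u v a1 a2 w1 w2 Ha Hw [c [Hc Hs]].
    now apply (complete_of_angle_bound b1 b2 H u v a1 a2 w1 w2 c).
- exists ex_b1, ex_b2; split; [exact ex_admissible|].
  rewrite (induced_metric_null ex_b1 ex_b2 ex_admissible).
  destruct ex_null_factor as [-> ->]; exact ex_incomplete.
Qed.
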